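(* Let Assumptions A, D (strict diagonal dominance) and S (asynchronous protocol) of the context hold; let $a_\infty=\|\Gamma\|_\infty$ (which is $<1$) and let $x^*$ be the unique Nash equilibrium. Let the asynchronous inexact proximal best-response scheme be applied with $\alpha_{i,k}=\eta^{\beta_{i,k}}$ for some $\eta\in(0,1)$, where $\beta_{i,k}$ is the number of updates player $i$ has carried out up to and including major iteration $k$, with $\mathbb E[\|x_{i,0}-x_i^*\|^2]\le C^2$ for all $i$, and with each inexact solution computed by the stochastic approximation scheme (SA) (see context). Let $n_0=\lceil B_2/B_1\rceil$, $\rho=\left(\max\{a_\infty,\eta\}\right)^{1/(n_0+1)}$, $c=\rho^{1/B_1}$, $q\in(c,1)$, $D\ge1/\ln\big((q/c)^e\big)$ ($e$ the base of the natural logarithm), $Q_i=\frac{2M_i^2}{\mu^2}+2D_{X_i}^2$, and $$\hat\epsilon=\frac{\epsilon}{C+D}\,\rho^{\frac{B_1-1}{B_1}} .$$ Then the number of projected gradient steps for player $i$ to compute an $\epsilon$-NE$_\infty$ is no greater than $$\ell_i^{(1)}(\eta)=\frac{Q_i}{\eta^4\ln(1/\eta^2)}\left(\frac1{\hat\epsilon}\right)^{\frac{\ln(1/\eta^2)}{\ln(1/q)}}+\left\lceil\frac{\ln(1/\hat\epsilon)}{\ln(1/q)}\right\rceil .$$ In particular, if $B_1=1$ and $B_2=0$, the bound reduces to $$\frac{Q_i}{\eta^4\ln(1/\eta^2)}\left(\frac{C+D}{\epsilon}\right)^{\frac{\ln(1/\eta^2)}{\ln(1/q)}}$$ with $q>c=\max\{a_\infty,\eta\}$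 and $D\ge1/\ln\big((q/c)^e\big)$.
   Context: Game. There are $N$ players $\mathcal N=\{1,\dots,N\}$. Player $i$ has strategy set $X_i\subseteq\mathbb R^{n_i}$; $X=\prod_i X_i$, $X_{-i}=\prod_{j\ne i}X_j$, $x_{-i}=(x_j)_{j\ne i}$. Let $\xi:\Omega\to\mathbb R^d$ be a random vector on a probability space $(\Omega,\mathcal F,\mathbb P)$. Given $x_{-i}\in X_{-i}$, player $i$ minimizes over $x_i\in X_i$ the function $f_i(x_i,x_{-i})=\mathbb E[\psi_i(x_i,x_{-i};\xi)]$. A Nash equilibrium is a point $x^*\in X$ such that, for every $i$, $x_i^*$ minimizes $f_i(\cdot,x_{-i}^* )$ over $X_i$. $\|\cdot\|$ is the Euclidean norm for vectors and the induced spectral norm for matrices; $\|\Gamma\|_\infty$ is the maximum absolute row sum. $D_{X_i}=\sup\{\|x_i-x_i'\|:x_i,x_i'\in X_i\}$. Assumption A. For every $i$: (a) $X_i$ is closed, compact and convex; (b) for every $x_{-i}\in X_{-i}$, $f_i(\cdot,x_{-i})$ is convex and twice continuously differentiable on an open set containing $X_i$; moreover $f_i$ is twice differentiable in $x$; (c) for all $x_{-i}\in X_{-i}$ and all $\omega\in\Omega$, $\psi_i(\cdot,x_{-i};\xi(\omega))$ is differentiable on an open set containing $X_i$, and $\nabla_{x_i}f_i(x_i,x_{-i})=\mathbb E[\nabla_{x_i}\psi_i(x_i,x_{-i};\xi)]$; (d) there is $M_i>0$ with $\mathbb E[\|\nabla_{x_i}\psi_i(x_i,x_{-i};\xi)\|^2]\le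 M_i^2$ for all $x\in X$. Proximal best-response. Fix $\mu>0$. For $y\in X$, $\hat x_i(y)=\operatorname{argmin}_{x_i\in X_i}\left[f_i(x_i,y_{-i})+\frac{\mu}{2}\|x_i-y_i\|^2\right]$. Matrix $\Gamma$. Let $\zeta_{i,\min}=\inf_{x\in X}\lambda_{\min}(\nabla^2_{x_i}f_i(x))$ and $\zeta_{ij,\max}=\sup_{x\in X}\|\nabla^2_{x_ix_j}f_i(x)\|$ for $j\ne i$, where $\lambda_{\min}(A)$ is the smallest eigenvalue of $(A+A^T)/2$. $\Gamma\in\mathbb R^{N\times N}$ has entries $\Gamma_{ii}=\frac{\mu}{\mu+\zeta_{i,\min}}$ and $\Gamma_{ij}=\frac{\zeta_{ij,\max}}{\mu+\zeta_{i,\min}}$ for $j\neq i$. Assumption D (strict diagonal dominance). $\zeta_{i,\min}>\sum_{j\ne i}\zeta_{ij,\max}$ for $i=1,\dots,N$. (Under Assumptions A and D, $\|\Gamma\|_\infty<1$ and the game has a unique Nash equilibrium $x^*$.) Asynchronous inexact proximal best-response scheme. Start from $x_{i,0}\in X_i$. At each major iteration $k=0,1,2,\dots$ let $I_k\subseteq\mathcal N$ be the set of players that update. For $i\in I_k$, player $i$ has access to the outdated data $y_k^i=(x_{1,k-\tau_{i1}(k)},\dots,x_{N,k-\tau_{iN}(k)})$, where $\tau_{ij}(k)\in\{0,\dots,k\}$ are random nonnegative integers (communication delays), $\tau_{ii}(k)=0$. If $i\in I_k$, player $i$ computes an $X_i$-valued $x_{i,k+1}$ satisfying the inexactness requirement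 $\mathbb E[\|x_{i,k+1}-\hat x_i(y_k^i)\|^2\mid\mathcal F_k]\le\alpha_{i,k}^2$ almost surely; otherwise $x_{i,k+1}=x_{i,k}$. Scheme (SA). If $i\in I_k$, player $i$ takes projected stochastic gradient steps $t=1,\dots,j_{i,k}$, where $j_{i,k}$ steps suffice to obtain an inexact solution of accuracy $\alpha_{i,k}$: $z_{i,1}=x_{i,k}$, $$z_{i,t+1}=\Pi_{X_i}\left[z_{i,t}-\gamma_t\left(\nabla_{x_i}\psi_i(z_{i,t},y_{-i,k}^i;\xi_{i,k}^t)+\mu(z_{i,t}-x_{i,k})\right)\right],\qquad\gamma_t=\frac1{\mu(t+1)},$$ and $x_{i,k+1}=z_{i,j_{i,k}}$, where $\Pi_{X_i}$ is Euclidean projection onto $X_i$ and $y_{-i,k}^i$ is $y_k^i$ without its $i$th block. Here $\xi_{i,k}^t$ are samples of $\xi$, and $\nabla_{x_i}\psi_i(z_{i,t},y_{-i,k}^i;\xi_{i,k}^t)$ is the sampled gradient at $(z_{i,t},y_{-i,k}^i)$ returned by a stochastic oracle, an unbiased estimator of $\nabla_{x_i}f_i(z_{i,t},y_{-i,k}^i)$. With $\tau_i(k)=(\tau_{i1}(k),\dots,\tau_{iN}(k))$, $\mathcal F_k=\sigma\{x_0,\ \{\xi_{i,l}^1,\dots,\xi_{i,l}^{j_{i,l}}\}_{i\in I_l,\,0\le l\le k-1},\ \{\tau_i(l)\}_{i\in I_l,\,0\le l\le k}\}$. The number of projected gradient steps of player $i$ is the total of the $j_{i,k}$ over the major iterations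 carried out in which player $i$ updates. Assumption S. (a) The sequence of sets $\{I_k\}_{k\ge0}$ is deterministic. (b) Each player $i$ updates at least once during any time interval of length $b_i$, and there is a positive integer $B_1$ with $b_i\le B_1$ for all $i$. (c) There are random variables $\tau_{ij}$ with $\tau_{ij}(k)\le\tau_{ij}$ almost surely for all $k\ge0$, $i\in I_k$, $j\in\mathcal N$, and a nonnegative integer $B_2$ with $\tau_{ij}\le B_2$ almost surely for all $i,j$. A random strategy profile $x$ is an $\epsilon$-NE$_\infty$ if $\max_{i\in\mathcal N}\mathbb E[\|x_i-x_i^*\|]\le\epsilon$.
   Formalization: The communication delays are assumed independent of the starting point and the samples (the bound fails for delays chosen after seeing x_0); the ceiling term is replaced by its maximum with 0, since it can be negative for large ε; j_{i,k}=0 (no step) is allowed. *)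

(* Defs.v *)
From HB Require Import structures.
From mathcomp Require Import all_boot all_order all_algebra.
From mathcomp Require Import all_classical all_reals all_analysis.

Set Implicit Arguments.
Unset Strict Implicit.
Unset Printing Implicit Defensive.

Import Order.TTheory GRing.Theory Num.Theory.
Import numFieldNormedType.Exports.

Local Open Scope classical_set_scope.
Local Open Scope ring_scope.

Section Euclidean.
Context {R : realType}.

(* The library norm on matrices is the max norm (it induces the same topology).
   This one is the Euclidean norm when applied to a row or a column vector. *)
Definition enorm m n (v : 'M[R]_(m, n)) : R :=
  Num.sqrt (\sum_i \sum_j v i j ^+ 2).

Definition spectral_norm m n (A : 'M[R]_(m, n)) : R :=
  sup [set enorm (A *m v) | v in [set v : 'cV[R]_n | enorm v <= 1]].

Definition lambda_min n (A : 'M[R]_n) : R :=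
  inf [set a | eigenvalue (2^-1 *: (A + A^T)) a].

Definition infty_norm m n (A : 'M[R]_(m, n)) : R :=
  \big[Num.max/0]_i \sum_j `|A i j|.

Definition diameter n (A : set 'rV[R]_n) : R :=
  sup [set enorm (u.1 - u.2) | u in A `*` A].

(* some minimizer of F over A, and 0 if there is none *)
Definition argmin n (A : set 'rV[R]_n) (F : 'rV[R]_n -> R) : 'rV[R]_n :=
  xget 0 [set u | A u /\ forall v, A v -> F u <= F v].

Definition proj n (A : set 'rV[R]_n) (v : 'rV[R]_n) : 'rV[R]_n :=
  argmin A (fun u => enorm (u - v)).

Definition C2_on n (O : set 'rV[R]_n) (g : 'rV[R]_n -> R) : Prop :=
  forall u, O u ->
    [/\ differentiable g u,
        forall k, differentiable ('D_(delta_mx 0 k) g) u &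
        forall k l, {for u, continuous ('D_(delta_mx 0 l) ('D_(delta_mx 0 k) g))}].

Definition twice_differentiable n (g : 'rV[R]_n -> R) (x : 'rV[R]_n) : Prop :=
  (\forall y \near x, differentiable g y) /\
  forall k, differentiable ('D_(delta_mx 0 k) g) x.

End Euclidean.

Section Probability.

Definition borel (T : topologicalType) : set (set T) := <<s [set A | open A] >>.

Definition sigma_of (Omega : Type) (T : topologicalType) (Y : Omega -> T) :
  set (set Omega) := [set Y @^-1` B | B in @borel T].

Context {R : realType} {d : measure_display} {Omega : measurableType d}.
Variable P : probability Omega R.

Definition random_element (T : topologicalType) (Y : Omega -> T) : Prop :=
  sigma_of Y `<=` measurable.

Definition same_law (T : topologicalType) (Y Z : Omega -> T) : Prop :=
  forall B, @borel T B -> P (Y @^-1` B) = P (Z @^-1` B).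

Definition independent (G H : set (set Omega)) : Prop :=
  forall A B, G A -> H B -> P (A `&` B) = (P A * P B)%E.

(* Z is a version of the conditional expectation E[Y | G] *)
Definition is_cond_exp (G : set (set Omega)) (Y Z : Omega -> R) : Prop :=
  [/\ forall B, measurable B -> G (Z @^-1` B),
      P.-integrable setT (EFin \o Z) &
      forall A, G A -> (\int[P]_(w in A) (Z w)%:E = \int[P]_(w in A) (Y w)%:E)%E].

(* E[Y | G] <= b almost surely *)
Definition cond_exp_le (G : set (set Omega)) (Y : Omega -> R) (b : R) : Prop :=
  exists2 Z, is_cond_exp G Y Z & {ae P, forall w, Z w <= b}.

End Probability.

(* A strategy profile is the concatenation in R^(n_1 + ... + n_N) of the
   players' strategies. *)
Section Profiles.
Context {R : realType} {N : nat} {n : 'I_N -> nat}.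
Local Notation profile := ('rV[R]_(\sum_i n i)).

Definition block (i : 'I_N) (x : profile) : 'rV[R]_(n i) := submxrow x i.

(* the profile (u, x_{-i}) *)
Definition upd (x : profile) (i : 'I_N) (u : 'rV[R]_(n i)) : profile :=
  \mxrow_j eqtype.dfwith (block^~ x) u j.

Definition profiles (X : forall i, set 'rV[R]_(n i)) : set profile :=
  [set x | forall i, X i (block i x)].

(* unit vector of coordinate k of player i *)
Definition unit_vec (i : 'I_N) (k : 'I_(n i)) : profile :=
  delta_mx 0 (tagnat.Rank i k).

Definition grad (i : 'I_N) (g : profile -> R) (x : profile) : 'rV[R]_(n i) :=
  \row_k 'D_(unit_vec k) g x.

Definition hess (i j : 'I_N) (g : profile -> R) (x : profile) :
    'M[R]_(n i, n j) :=
  \matrix_(k, l) 'D_(unit_vec l) ('D_(unit_vec k) g) x.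

End Profiles.

Section Game.
Context {R : realType} {d : measure_display} {Omega : measurableType d}.
Context {N m : nat} {n : 'I_N -> nat}.
Local Notation profile := ('rV[R]_(\sum_i n i)).
Variables (P : probability Omega R) (xi : Omega -> 'rV[R]_m).
Variables (X : forall i, set 'rV[R]_(n i)).
Variables (psi : 'I_N -> profile -> 'rV[R]_m -> R).

Definition cost (i : 'I_N) (x : profile) : R :=
  fine ('E_P[fun w => psi i x (xi w)])%E.

Definition nash (x : profile) : Prop :=
  profiles X x /\
  forall i (u : 'rV[R]_(n i)), X u -> cost i x <= cost i (upd x u).

Record assumptionA (M : 'I_N -> R) : Prop := AssumptionA {
  A_closed : forall i, closed (@X i);
  A_compact : forall i, compact (@X i);
  A_convex : forall i, convex_set (@X i);
  (* the cost functions are well defined, and so are the sampled gradients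
     along random profiles *)
  A_noise : random_element xi;
  A_integrable : forall i x, profiles X x ->
    P.-integrable setT (fun w => (psi i x (xi w))%:E);
  A_measurable : forall i (B : set 'rV[R]_(n i)), borel B ->
    borel [set xw : profile * 'rV[R]_m |
      profiles X xw.1 /\ B (grad i (psi i ^~ xw.2) xw.1)];
  A_C2 : forall i x, profiles X x ->
    exists O : set 'rV[R]_(n i),
      [/\ open O, @X i `<=` O, convex_set O,
          convex_function O (fun u => cost i (upd x u)) &
          C2_on O (fun u => cost i (upd x u))];
  A_twice : forall i x, profiles X x -> twice_differentiable (cost i) x;
  A_psi_diff : forall i x w, profiles X x ->
    exists O : set 'rV[R]_(n i),
      [/\ open O, @X i `<=` O &
          forall u, O u ->
            differentiable (fun v => psi i (upd x v) (xi w)) u];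
  A_grad : forall i x k, profiles X x ->
    (grad i (cost i) x 0 k)%:E =
      ('E_P[fun w => grad i (psi i ^~ (xi w)) x 0%R k])%E;
  A_bound_gt0 : forall i, 0 < M i;
  A_bound : forall i x, profiles X x ->
    ('E_P[fun w => (enorm (grad i (psi i ^~ (xi w)) x) ^+ 2)%R]
       <= (M i ^+ 2)%:E)%E
}.

(* These are extended reals since a real supremum of an unbounded set is junk. *)
Definition zeta_min (i : 'I_N) : \bar R :=
  ereal_inf [set (lambda_min (hess i i (cost i) x))%:E | x in profiles X].

Definition zeta_max (i j : 'I_N) : \bar R :=
  ereal_sup [set (spectral_norm (hess i j (cost i) x))%:E | x in profiles X].

Definition assumptionD : Prop :=
  forall i, (\sum_(j | j != i) zeta_max i j < zeta_min i)%E.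

Definition Gamma (mu : R) : 'M[R]_N :=
  \matrix_(i, j) ((if i == j then mu else fine (zeta_max i j)) /
                  (mu + fine (zeta_min i))).

(* proximal best response of player i to y *)
Definition prox_br (mu : R) (i : 'I_N) (y : profile) : 'rV[R]_(n i) :=
  argmin (@X i) (fun u => cost i (upd y u) +
                          mu / 2 * enorm (u - block i y) ^+ 2).

(* z_{i,t}, started (at t = 1) and centred at c, for rivals' data y and samples
   smp 1, smp 2, ...; the value c at t = 0 means that no step is taken. *)
Fixpoint sa_iter (mu : R) (i : 'I_N) (y : profile) (c : 'rV[R]_(n i))
    (smp : nat -> 'rV[R]_m) (t : nat) : 'rV[R]_(n i) :=
  if t is s.+1 then
    if s == 0%N then c else
    let z := sa_iter mu y c smp s in
    proj (@X i) (z - (mu * (s%:R + 1))^-1 *: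
                   (grad i (psi i ^~ (smp s)) (upd y z) + mu *: (z - c)))
  else c.

End Game.

Section Scheme.
Context {R : realType} {d : measure_display} {Omega : measurableType d}.
Context {N m : nat} {n : 'I_N -> nat}.
Local Notation profile := ('rV[R]_(\sum_i n i)).
Variables (P : probability Omega R) (xi : Omega -> 'rV[R]_m).
Variables (X : forall i, set 'rV[R]_(n i)).
Variables (psi : 'I_N -> profile -> 'rV[R]_m -> R).
Variables (I : nat -> {set 'I_N}).
(* tau i j k : delay at iteration k in player i's information on player j *)
Variables (tau : 'I_N -> 'I_N -> nat -> Omega -> nat).
Variable (x0 : Omega -> profile).
(* smp i k t : sample used by player i in gradient step t >= 1 of iteration k *)
Variable (smp : 'I_N -> nat -> nat -> Omega -> 'rV[R]_m).

Definition delays_ok : Prop :=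
  forall k i, i \in I k ->
    [/\ forall j, random_element (tau i j k),
        forall j w, (tau i j k w <= k)%N &
        forall w, tau i i k w = 0%N].

Definition assumptionS (b : 'I_N -> nat) (B1 B2 : nat)
    (taubar : 'I_N -> 'I_N -> Omega -> nat) : Prop :=
  [/\ forall i k, exists2 l, (k <= l < k + b i)%N & i \in I l,
      (0 < B1)%N,
      forall i, (b i <= B1)%N,
      forall i j, random_element (taubar i j) &
      (forall k i j, i \in I k ->
        {ae P, forall w, (tau i j k w <= taubar i j w)%N}) /\
      (forall i j, {ae P, forall w, (taubar i j w <= B2)%N})].

(* sigma-algebra of the starting point and of the samples drawn strictly before
   the t-th one of player i at iteration k *)
Definition sample_past (i : 'I_N) (k t : nat) : set (set Omega) :=
  <<s [set A | [\/ sigma_of x0 A,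
                   exists j l s,
                     [/\ (l < k)%N, (0 < s)%N & sigma_of (smp j l s) A] |
                   exists2 s, (0 < s < t)%N & sigma_of (smp i k s) A]] >>.

Definition all_samples : set (set Omega) :=
  <<s [set A | sigma_of x0 A \/
               exists i k t, (0 < t)%N /\ sigma_of (smp i k t) A] >>.

Definition all_delays : set (set Omega) :=
  <<s [set A | exists i j k, i \in I k /\ sigma_of (tau i j k) A] >>.

(* Each sample has the law of xi and is independent of the earlier ones and of
   the starting point; the communication delays are exogenous. *)
Definition sampling : Prop :=
  [/\ forall i k t, random_element (smp i k t),
      forall i k t, i \in I k -> (0 < t)%N -> same_law P (smp i k t) xi,
      forall i k t, i \in I k -> (0 < t)%N ->
        independent P (sigma_of (smp i k t)) (sample_past i k t) &
      independent P all_delays all_samples].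

(* the outdated data y^i_k *)
Definition outdated (x : nat -> Omega -> profile) (i : 'I_N) (k : nat)
    (w : Omega) : profile :=
  \mxrow_j block j (x (k - tau i j k w)%N w).

(* jj i k is the number of gradient steps j_{i,k} *)
Definition sa_run (mu : R) (jj : 'I_N -> nat -> nat)
    (x : nat -> Omega -> profile) : Prop :=
  x 0%N = x0 /\
  forall k w i, block i (x k.+1 w) =
    if i \in I k then
      sa_iter X psi mu (outdated x i k w) (block i (x k w))
              (fun t => smp i k t w) (jj i k)
    else block i (x k w).

(* F_k *)
Definition filtration (jj : 'I_N -> nat -> nat) (k : nat) : set (set Omega) :=
  <<s [set A | [\/ sigma_of x0 A,
                   exists i l t, [/\ (l < k)%N, i \in I l,
                     (1 <= t <= jj i l)%N & sigma_of (smp i l t) A] |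
                   exists i j l, [/\ (l <= k)%N, i \in I l &
                     sigma_of (tau i j l) A]]] >>.

(* beta_{i,k} *)
Definition nb_updates (i : 'I_N) (k : nat) : nat :=
  (\sum_(l < k.+1) (i \in I l))%N.

Definition inexact (mu : R) (alpha : 'I_N -> nat -> R)
    (jj : 'I_N -> nat -> nat) (x : nat -> Omega -> profile) : Prop :=
  forall k i, i \in I k ->
    cond_exp_le P (filtration jj k)
      (fun w => enorm (block i (x k.+1 w) -
                       prox_br P xi X psi mu i (outdated x i k w)) ^+ 2)
      (alpha i k ^+ 2).

(* gradient steps of player i over the major iterations 0, ..., K - 1 *)
Definition nb_steps (jj : 'I_N -> nat -> nat) (i : 'I_N) (K : nat) : nat :=
  (\sum_(k < K | i \in I k) jj i k)%N.

Definition eps_NE_infty (xstar : profile) (eps : R) (x : Omega -> profile) :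
    Prop :=
  (\big[Order.max/-oo]_i
     'E_P[fun w => enorm (block i (x w) - block i xstar)%R] <= eps%:E)%E.

End Scheme.

(* Main.v *)
(* Adding the variational inequalities of two proximal best responses and
   applying the mean value theorem to the partial gradients shows that the
   best-response map contracts with the matrix Gamma, whose row sums are at most
   a < 1 by diagonal dominance; the Nash equilibrium is its fixed point.
   Given the past, t stochastic gradient steps with step sizes 1 / (mu (t + 1))
   bring the mean squared distance to the best response below Q / (t + 1), by
   strong monotonicity.  The delays are independent of the samples but not of
   each other, so both facts are used on every event of the sigma-algebra of
   the delays: E[1_A |x_k - x*|] <= u_k P(A), where u_k obeys a deterministic
   delayed recursion with factor a and perturbation eta^beta_k.  Every window of
   B1 iterations gains a factor rho, whence u_k <= rho^floor(k / B1) (C + k), and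
   k c^k <= D q^k turns this into the number of iterations.  The number of steps
   is a geometric sum bounded with 1 + ln r <= r, where r = 1 / eta^2. *)
Require Import Defs.
From HB Require Import structures.
From mathcomp Require Import all_boot all_order all_algebra.
From mathcomp Require Import all_classical all_reals all_analysis.
From mathcomp Require Import measurable_realfun.
From mathcomp Require Import ring lra.

Set Implicit Arguments.
Unset Strict Implicit.
Unset Printing Implicit Defensive.

Import Order.TTheory GRing.Theory Num.Theory.
Import numFieldNormedType.Exports.

Local Open Scope classical_set_scope.
Local Open Scope ring_scope.

(** Projections and best responses are chosen minimizers, so their measurability is not given; both
    maps are Lipschitz on the strategy sets, and this makes every iterate measurable with respect to
    its past. The inexactness requirement is a conclusion here: the numbers of steps form a
    deterministic schedule read off from the bound Q / (t + 1), the same for all q, D and eps, and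
    the conditional expectation is built as a Radon-Nikodym density. Errors propagate in first
    moments, where the triangle inequality lets the row sums of Gamma act; the second moments of the
    gradient steps enter through their square roots. Origin of the constants: Q comes from |g + mu
    s|^2 <= 2 |g|^2 + 2 mu^2 |s|^2 at step size 1 / (mu t). The factor rho^((B1 - 1) / B1) in epshat
    pays for the floor in k / B1. The power eta^-4 is r^2: one factor r stems from rounding the
    number of iterations up, the other from the geometric sum. *)

(** * Euclidean geometry *)

Section Dot.
Context {R : realType} {m n : nat}.
Implicit Types u v w : 'M[R]_(m, n).

Definition dot u v : R := \sum_i \sum_j u i j * v i j.

Lemma dotC u v : dot u v = dot v u.
Proof. by apply: eq_bigr => i _; apply: eq_bigr => j _; rewrite mulrC. Qed.

Lemma dotDl u v w : dot (u + v) w = dot u w + dot v w.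
Proof.
rewrite /dot -big_split; apply: eq_bigr => i _; rewrite -big_split.
by apply: eq_bigr => j _; rewrite mxE mulrDl.
Qed.

Lemma dotZl c u v : dot (c *: u) v = c * dot u v.
Proof.
rewrite /dot mulr_sumr; apply: eq_bigr => i _; rewrite mulr_sumr.
by apply: eq_bigr => j _; rewrite mxE mulrA.
Qed.

Lemma dotNl u v : dot (- u) v = - dot u v.
Proof. by rewrite -scaleN1r dotZl mulN1r. Qed.

Lemma dotBl u v w : dot (u - v) w = dot u w - dot v w.
Proof. by rewrite dotDl dotNl. Qed.

Lemma dotDr u v w : dot u (v + w) = dot u v + dot u w.
Proof. by rewrite dotC dotDl !(dotC u). Qed.

Lemma dotZr c u v : dot u (c *: v) = c * dot u v.
Proof. by rewrite dotC dotZl dotC. Qed.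

Lemma dotNr u v : dot u (- v) = - dot u v.
Proof. by rewrite dotC dotNl dotC. Qed.

Lemma dotBr u v w : dot u (v - w) = dot u v - dot u w.
Proof. by rewrite dotDr dotNr. Qed.

Lemma dot0r u : dot u 0 = 0.
Proof. by rewrite -(scale0r 0) dotZr mul0r. Qed.

Lemma dotvv_ge0 u : 0 <= dot u u.
Proof. by apply: sumr_ge0 => i _; apply: sumr_ge0 => j _; rewrite -expr2 sqr_ge0. Qed.

Lemma enorm_sqr u : enorm u ^+ 2 = dot u u.
Proof.
have E : \sum_i \sum_j u i j ^+ 2 = dot u u.
  by apply: eq_bigr => i _; apply: eq_bigr => j _; rewrite expr2.
by rewrite /enorm E sqr_sqrtr // dotvv_ge0.
Qed.

Lemma enorm_ge0 u : 0 <= enorm u.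
Proof. exact: sqrtr_ge0. Qed.

Lemma enorm_sqrD u v :
  enorm (u + v) ^+ 2 = enorm u ^+ 2 + 2 * dot u v + enorm v ^+ 2.
Proof. by rewrite !enorm_sqr dotDl !dotDr (dotC v u); ring. Qed.

Lemma enormZ c u : enorm (c *: u) = `|c| * enorm u.
Proof.
apply/eqP; rewrite -(eqrXn2 (n := 2)) ?mulr_ge0 ?enorm_ge0 //.
by rewrite exprMn !enorm_sqr dotZl dotZr -normrX ger0_norm ?sqr_ge0 // mulrA expr2.
Qed.

Lemma enormN u : enorm (- u) = enorm u.
Proof. by rewrite -scaleN1r enormZ normrN normr1 mul1r. Qed.

Lemma enormB u v : enorm (u - v) = enorm (v - u).
Proof. by rewrite -enormN opprB. Qed.

Lemma enorm_sqrB u v :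
  enorm (u - v) ^+ 2 = enorm u ^+ 2 - 2 * dot u v + enorm v ^+ 2.
Proof. by rewrite enorm_sqrD dotNr enormN; ring. Qed.

Lemma enorm0 : enorm (0 : 'M[R]_(m, n)) = 0.
Proof. by rewrite -(scale0r 0) enormZ normr0 mul0r. Qed.

Lemma coord_le_enorm u i j : `|u i j| <= enorm u.
Proof.
rewrite -ler_sqr ?nnegrE ?enorm_ge0 // enorm_sqr /dot.
rewrite (bigD1 i) //= (bigD1 j) //= -addrA -normrX ger0_norm ?sqr_ge0 // expr2.
rewrite lerDl addr_ge0 // sumr_ge0 // => k _; rewrite -?expr2 ?sqr_ge0 //.
by apply: sumr_ge0 => l _; rewrite -expr2 sqr_ge0.
Qed.

Lemma enorm_eq0 u : enorm u = 0 -> u = 0.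
Proof.
move=> u0; apply/matrixP => i j; rewrite mxE; apply/eqP.
by rewrite -normr_le0 -u0 coord_le_enorm.
Qed.

(** Cauchy-Schwarz, by expanding the square of the norm of |v| u - |u| v and dividing by 2 |u|
    |v|. *)
Lemma dot_le u v : dot u v <= enorm u * enorm v.
Proof.
have [v0|v0] := eqVneq (enorm v) 0.
  by rewrite (enorm_eq0 v0) dot0r enorm0 mulr0.
have [u0|u0] := eqVneq (enorm u) 0.
  by rewrite (enorm_eq0 u0) dotC dot0r enorm0 mul0r.
have up : 0 < enorm u by rewrite lt_neqAle eq_sym u0 enorm_ge0.
have vp : 0 < enorm v by rewrite lt_neqAle eq_sym v0 enorm_ge0.
have := sqr_ge0 (enorm (enorm v *: u - enorm u *: v)).
rewrite enorm_sqrB !enormZ dotZl dotZr !(ger0_norm (enorm_ge0 _)) => h.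
have {h} : enorm u * enorm v * (enorm u * enorm v - dot u v) >= 0 by nra.
by rewrite pmulr_rge0 ?mulr_gt0 // subr_ge0.
Qed.

Lemma normr_dot_le u v : `|dot u v| <= enorm u * enorm v.
Proof.
by rewrite ler_norml dot_le andbT lerNl -dotNl -(enormN u) dot_le.
Qed.

Lemma enormD u v : enorm (u + v) <= enorm u + enorm v.
Proof.
rewrite -ler_sqr ?nnegrE ?addr_ge0 ?enorm_ge0 // enorm_sqrD sqrrD.
by have := dot_le u v; lra.
Qed.

End Dot.

(** On a matrix [enorm] is the Frobenius norm, and Cauchy-Schwarz applies to each row. This makes
    the supremum in [spectral_norm] finite. *)
Lemma enorm_mulmx (R : realType) m n (A : 'M[R]_(m, n)) (v : 'cV[R]_n) :
  enorm (A *m v) <= enorm A * enorm v.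
Proof.
rewrite -ler_sqr ?nnegrE ?mulr_ge0 ?enorm_ge0 // exprMn [enorm (A *m v) ^+ 2]enorm_sqr.
rewrite [enorm A ^+ 2]enorm_sqr /dot mulr_suml; apply: ler_sum => i _.
rewrite big_ord1 mxE -expr2.
have -> : \sum_j A i j * v j 0 = dot (row i A) (v^T).
  by rewrite /dot big_ord1; apply: eq_bigr => j _; rewrite !mxE.
have -> : \sum_j A i j * A i j = enorm (row i A) ^+ 2.
  by rewrite enorm_sqr /dot big_ord1; apply: eq_bigr => j _; rewrite !mxE.
have -> : enorm v ^+ 2 = enorm v^T ^+ 2.
  rewrite !enorm_sqr /dot big_ord1; apply: eq_bigr => j _.
  by rewrite big_ord1 !mxE.
rewrite -exprMn -[leLHS]ger0_norm ?sqr_ge0 // normrX.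
by rewrite lerXn2r ?nnegrE ?mulr_ge0 ?enorm_ge0 // normr_dot_le.
Qed.

Lemma enorm_continuous (R : realType) n : continuous (@enorm R 1 n).
Proof.
move=> u; apply: (@continuous_comp _ _ _ _ Num.sqrt); last exact: sqrt_continuous.
apply: (continuous_big add_continuous) => i _.
apply: (continuous_big add_continuous) => j _ {}u.
apply: (@continuous_comp _ _ _ (fun w : 'rV[R]_n => w i j) (fun x => x ^+ 2)).
  exact: coord_continuous.
exact: exprn_continuous.
Qed.

Lemma enormB_continuous (R : realType) n (w : 'rV[R]_n) :
  continuous (fun u : 'rV[R]_n => enorm (u - w)).
Proof.
move=> u.
apply: (@cvg_comp _ _ _ (fun u : 'rV[R]_n => u - w) (@enorm R 1 n));
  last exact: enorm_continuous.
apply: (@continuousB R _ _ id (fun=> w)); [exact: cvg_id|exact: cst_continuous].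
Qed.

(** * Minimizers and projections on compact convex sets *)

Section Projection.
Context {R : realType} {n : nat}.
Implicit Types (A : set 'rV[R]_n) (u v w : 'rV[R]_n).

Lemma argmin_spec A (F : 'rV[R]_n -> R) : A !=set0 -> compact A ->
  {within A, continuous F} ->
  A (argmin A F) /\ forall v, A v -> F (argmin A F) <= F v.
Proof.
move=> A0 cA cF; have [u Au Fu] := EVT_min_rV A0 cA cF.
rewrite /argmin; case: xgetP => [w _ [Aw Fw]//|/(_ u)/=[]].
by move: Au; rewrite inE => Au; split => // v Av; apply: Fu; rewrite inE.
Qed.

Lemma convex_setP A u v (t : R) : convex_set A -> A u -> A v ->
  0 <= t <= 1 -> A (t *: u + (1 - t) *: v).
Proof.
move=> cA Au Av /andP[t0 t1].
have := cA u v (Itv01 t0 t1) (mem_set Au) (mem_set Av).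
by rewrite inE.
Qed.

Lemma proj_spec A u : A !=set0 -> compact A ->
  A (Defs.proj A u) /\ forall v, A v -> enorm (Defs.proj A u - u) <= enorm (v - u).
Proof.
move=> A0 cA; apply: argmin_spec => //.
by apply: continuous_subspaceT; exact: enormB_continuous.
Qed.


(* t |-> |w + t (v - w) - u|^2 is minimal at t = 0. *)
Lemma proj_angle A u w v : convex_set A -> A w -> A v ->
  (forall v, A v -> enorm (w - u) <= enorm (v - u)) ->
  dot (u - w) (v - w) <= 0.
Proof.
move=> cA Aw Av wmin; rewrite leNgt; apply/negP => p_gt0.
set p := dot (u - w) (v - w) in p_gt0.
pose q := enorm (v - w) ^+ 2.
have q0 : 0 <= q by exact: sqr_ge0.
have key t : 0 <= t <= 1 -> 2 * t * p <= t ^+ 2 * q.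
  move=> t01; move: (wmin _ (convex_setP cA Av Aw t01)).
  rewrite -(ler_sqr (enorm_ge0 _) (enorm_ge0 _)).
  have -> : t *: v + (1 - t) *: w - u = (w - u) + t *: (v - w).
    by rewrite scalerBl scale1r scalerBr; apply/matrixP => i j; rewrite !mxE; ring.
  rewrite (enorm_sqrD (w - u)) enormZ dotZr exprMn real_normK ?num_real //.
  rewrite -[w - u]opprB dotNl -/p -/q; lra.
(* The denominator p + q keeps t in (0, 1] for every q >= 0; then t q <= p, against 2 p <= t q from
   [key]. *)
pose t := p / (p + q).
have pq : 0 < p + q by lra.
have t0 : 0 < t by rewrite divr_gt0.
have t1 : t <= 1 by rewrite ler_pdivrMr // mul1r; lra.
have /key : 0 <= t <= 1 by rewrite t1 ltW.
have -> : t ^+ 2 * q = t * (t * q) by ring.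
rewrite -mulrA mulrCA ler_pM2l // => h.
have : t * q <= p by rewrite /t mulrAC ler_pdivrMr // ; nra.
lra.
Qed.

(** The two obtuse-angle inequalities add up to |p - q|^2 <= <p - q, u - v>, and Cauchy-Schwarz
    cancels one factor. It serves both the gradient step and the measurability of the projection. *)
Lemma proj_lipschitz A u v : A !=set0 -> compact A -> convex_set A ->
  enorm (Defs.proj A u - Defs.proj A v) <= enorm (u - v).
Proof.
move=> A0 cA cvA; have [Au pu] := proj_spec u A0 cA.
have [Av pv] := proj_spec v A0 cA.
have h1 := proj_angle cvA Au Av pu; have h2 := proj_angle cvA Av Au pv.
set p := Defs.proj A u in Au pu h1 h2 *; set q := Defs.proj A v in Av pv h1 h2 *.
have [->//|d0] := eqVneq (enorm (p - q)) 0; first exact: enorm_ge0.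
have dp : 0 < enorm (p - q) by rewrite lt_neqAle eq_sym d0 enorm_ge0.
rewrite -(ler_pM2l dp); apply: le_trans (dot_le _ _).
rewrite -expr2 enorm_sqr.
rewrite -subr_ge0 -dotBr; suff -> : dot (p - q) (u - v - (p - q)) =
  - (dot (u - p) (q - p) + dot (v - q) (p - q)) by lra.
by rewrite !(dotBl, dotBr) (dotC u q) (dotC u p) (dotC v q) (dotC v p) (dotC q p); ring.
Qed.

Lemma proj_id A u : A u -> compact A -> Defs.proj A u = u.
Proof.
move=> Au cA; have [_ /(_ _ Au)] := proj_spec u (ex_intro _ u Au) cA.
by rewrite subrr enorm0 => h; apply/subr0_eq/enorm_eq0/le_anti; rewrite h enorm_ge0.
Qed.

(** [diameter] is a real supremum, so boundedness has to be shown: twice the largest distance to u,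
    attained by compactness, is an upper bound. *)
Lemma diameter_ge A u v : compact A -> A u -> A v -> enorm (u - v) <= diameter A.
Proof.
move=> cA Au Av; apply: ub_le_sup; last by exists (u, v).
have cf : {within A, continuous (fun w => - enorm (w - u))}.
  apply: continuous_subspaceT => w.
  apply: (@cvg_comp _ _ _ (fun v : 'rV[R]_n => enorm (v - u)) -%R).
    exact: enormB_continuous.
  exact: opp_continuous.
have [w _ wmax] := EVT_min_rV (ex_intro _ u Au) cA cf.
exists (enorm (w - u) + enorm (w - u)) => _ [[x y] [/= Ax Ay] <-].
have -> : x - y = (x - u) + (u - y) by rewrite addrA subrK.
apply: (le_trans (enormD _ _)); rewrite (enormB u y).
by have := wmax x (mem_set Ax); have := wmax y (mem_set Ay); rewrite !lerN2 => ? ?; exact: lerD.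
Qed.

End Projection.

Lemma enorm_tr (R : realType) m n (A : 'M[R]_(m, n)) : enorm A^T = enorm A.
Proof.
rewrite /enorm exchange_big /=; congr Num.sqrt.
by apply: eq_bigr => i _; apply: eq_bigr => j _; rewrite mxE.
Qed.

(** * Quadratic forms *)

Section QuadraticForm.
Context {R : realType}.

Definition sympart n (A : 'M[R]_n) := 2^-1 *: (A + A^T).

Lemma dot_mulmx_tr m n (A : 'M[R]_(m, n)) (u : 'rV[R]_m) (v : 'rV[R]_n) :
  dot u (v *m A^T) = dot (u *m A) v.
Proof.
rewrite /dot !big_ord1.
under eq_bigr do rewrite mxE mulr_sumr.
rewrite exchange_big /=; apply: eq_bigr => j _.
by rewrite mxE mulr_suml; apply: eq_bigr => i _; rewrite mxE; ring.
Qed.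

Lemma dot_sympart n (A : 'M[R]_n) (u : 'rV[R]_n) :
  dot u (u *m sympart A) = dot u (u *m A).
Proof.
by rewrite -scalemxAr mulmxDr dotZr dotDr dot_mulmx_tr (dotC (u *m A)); field.
Qed.

Lemma sympart_tr n (A : 'M[R]_n) : (sympart A)^T = sympart A.
Proof. by apply/matrixP => i j; rewrite !mxE addrC. Qed.

Lemma dot_quad_continuous n (A : 'M[R]_n) :
  continuous (fun u : 'rV[R]_n => dot u (u *m A)).
Proof.
have -> : (fun u : 'rV[R]_n => dot u (u *m A)) =
    (fun u => \sum_i \sum_j u i j * \sum_k u i k * A k j).
  by apply/funext => u; apply: eq_bigr => i _; apply: eq_bigr => j _; rewrite mxE.
apply: (continuous_big add_continuous) => i _.
apply: (continuous_big add_continuous) => j _ u.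
apply: continuousM; first exact: coord_continuous.
apply: (continuous_big add_continuous) => k _ {}u.
by apply: continuousM; [exact: coord_continuous|exact: cst_continuous].
Qed.

(* The minimum of the form over the unit sphere is an eigenvalue. *)
Lemma lambda_min_le n (A : 'M[R]_n) (u : 'rV[R]_n) :
  lambda_min A * enorm u ^+ 2 <= dot u (u *m A).
Proof.
(* A nonzero u also guarantees that the sphere S is not empty, as it is in dimension 0. *)
have [->|u0] := eqVneq u 0; first by rewrite enorm0 dotC dot0r expr0n mulr0.
pose S := [set v : 'rV[R]_n | enorm v = 1].
have normS (v : 'rV[R]_n) : v != 0 -> S ((enorm v)^-1 *: v).
  move=> v0; have v1 : enorm v != 0 by apply: contra v0 => /eqP/enorm_eq0 ->.
  by rewrite /S/= enormZ ger0_norm ?invr_ge0 ?enorm_ge0 // mulVf.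
have S0 : S !=set0 by exists ((enorm u)^-1 *: u); exact: normS.
have cS : compact S.
  apply: bounded_closed_compact.
    exists 1; split=> // r r1 v vS; rewrite /= /Num.norm /= mx_normrE.
    apply: bigmax_le => [|i _]; first by rewrite ltW // (lt_trans _ r1).
    by rewrite (le_trans (coord_le_enorm _ _ _)) // vS ltW.
  have -> : S = @enorm R 1 n @^-1` [set 1] by [].
  apply: closed_comp; last exact: closed_eq.
  by move=> v _; exact: enorm_continuous.
have [v] := EVT_min_rV S0 cS (continuous_subspaceT (@dot_quad_continuous n A)).
rewrite inE => vS vmin; set l := dot v (v *m A) in vmin.
have lmin (w : 'rV[R]_n) : l * enorm w ^+ 2 <= dot w (w *m A).
  have [->|w0] := eqVneq w 0; first by rewrite enorm0 dotC dot0r expr0n mulr0.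
  have w1 : 0 < enorm w.
    by rewrite lt_neqAle enorm_ge0 andbT eq_sym; apply: contra w0 => /eqP/enorm_eq0 ->.
  have := vmin _ (mem_set (normS _ w0)).
  rewrite -scalemxAl dotZr dotZl mulrA -expr2 exprVn mulrC.
  by rewrite ler_pdivlMr ?exprn_gt0.
suff -> : lambda_min A = l by exact: lmin.
have vE : v *m sympart A = l *: v.
  apply/eqP; rewrite -subr_eq0; apply/eqP/enorm_eq0.
  (* The residual g is half the gradient of the Lagrangian at v. Comparing v with v + t g leaves 2 t
     |g|^2 + O(t^2) >= 0, and a small negative t forces g = 0. *)
  move gE : (v *m sympart A - l *: v) => g.
  have key (t : R) : 0 <= 2 * t * dot g g + t ^+ 2 * (dot g (g *m A) - l * dot g g).
    have := lmin (v + t *: g); rewrite -dot_sympart mulmxDl -scalemxAl.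
    rewrite enorm_sqrD vS !(dotDl, dotDr, dotZl, dotZr) enorm_sqr !(dotZl, dotZr).
    have -> : dot v (g *m sympart A) = dot g (v *m sympart A).
      by rewrite -{1}[sympart A]sympart_tr dot_mulmx_tr dotC.
    have -> : dot g (v *m sympart A) = dot g g + l * dot v g.
      by rewrite (dotC v) -dotZr -dotDr -{3}gE subrK.
    rewrite !dot_sympart -/l expr1n; lra.
  have [//|g0] := eqVneq (enorm g) 0.
  have gp : 0 < dot g g by rewrite -enorm_sqr exprn_gt0 // lt_neqAle eq_sym g0 enorm_ge0.
  set r := dot g (g *m A) - l * dot g g in key.
  have rp : 0 < `|r| + dot g g by rewrite ltr_wpDl.
  pose t := dot g g / (`|r| + dot g g).
  have := key (- t).
  have -> : 2 * - t * dot g g + (- t) ^+ 2 * r = t * (t * r - 2 * dot g g) by ring.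
  rewrite pmulr_rge0 ?divr_gt0 // subr_ge0 => h.
  have : t * r <= dot g g.
    rewrite /t mulrAC ler_pdivrMr // ler_wpM2l ?(ltW gp) //.
    by rewrite (le_trans (ler_norm _)) // lerDl ltW.
  lra.
have v0 : v != 0.
  by apply/eqP => v0; move: vS; rewrite /S/= v0 enorm0 => /eqP; rewrite eq_sym oner_eq0.
have ev : eigenvalue (sympart A) l by apply/eigenvalueP; exists v.
apply/le_anti/andP; split.
  apply: ge_inf => //; exists l => a /eigenvalueP[w wE w0].
  have := lmin w; rewrite -dot_sympart wE dotZr -enorm_sqr ler_pM2r //.
  by rewrite exprn_gt0 // lt_neqAle enorm_ge0 andbT eq_sym; apply: contra w0 => /eqP/enorm_eq0 ->.
apply: lb_le_inf; first by exists l.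
move=> a /eigenvalueP[w wE w0].
have := lmin w; rewrite -dot_sympart wE dotZr -enorm_sqr ler_pM2r //.
by rewrite exprn_gt0 // lt_neqAle enorm_ge0 andbT eq_sym; apply: contra w0 => /eqP/enorm_eq0 ->.
Qed.

Lemma spectral_norm_has_sup m n (A : 'M[R]_(m, n)) :
  has_sup [set enorm (A *m v) | v in [set v : 'cV[R]_n | enorm v <= 1]].
Proof.
split; first by exists (enorm (A *m (0 : 'cV[R]_n))), 0 => //=; rewrite enorm0 ler01.
exists (enorm A) => _ [v /= v1 <-]; apply: (le_trans (enorm_mulmx _ _)).
by rewrite ler_piMr ?enorm_ge0.
Qed.

Lemma spectral_norm_ge0 m n (A : 'M[R]_(m, n)) : 0 <= spectral_norm A.
Proof.
apply: sup_ubound; first by case: (spectral_norm_has_sup A).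
by exists 0; rewrite /= ?mulmx0 enorm0 ?ler01.
Qed.

Lemma spectral_normP m n (A : 'M[R]_(m, n)) (v : 'cV[R]_n) :
  enorm (A *m v) <= spectral_norm A * enorm v.
Proof.
have [v0|v0] := eqVneq (enorm v) 0; first by rewrite (enorm_eq0 v0) mulmx0 !enorm0 mulr0.
have vp : 0 < enorm v by rewrite lt_neqAle eq_sym v0 enorm_ge0.
rewrite -ler_pdivrMr // mulrC -[(enorm v)^-1]ger0_norm ?invr_ge0 ?enorm_ge0 //.
rewrite -enormZ scalemxAr; apply: sup_ubound; first by case: (spectral_norm_has_sup A).
by exists ((enorm v)^-1 *: v) => //=; rewrite enormZ ger0_norm ?invr_ge0 ?enorm_ge0 // mulVf.
Qed.

Lemma dot_spectral_norm m n (A : 'M[R]_(m, n)) (u : 'rV[R]_m) (v : 'rV[R]_n) :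
  `|dot (u *m A) v| <= spectral_norm A * enorm u * enorm v.
Proof.
rewrite -dot_mulmx_tr (le_trans (normr_dot_le _ _)) // mulrAC mulrC ler_wpM2r ?enorm_ge0 //.
by rewrite -[v in leLHS]trmxK -trmx_mul enorm_tr -(enorm_tr v) spectral_normP.
Qed.

End QuadraticForm.

(** * Gradients on strategy profiles *)

Section ProfileAlgebra.
Context {R : realType} {N : nat} {n : 'I_N -> nat}.
Local Notation profile := ('rV[R]_(\sum_i n i)).
Implicit Types (x y p : profile).

Lemma profileP x y : (forall i, block i x = block i y) -> x = y.
Proof. by move=> h; apply/mxrowP. Qed.

Lemma block_upd x i (u : 'rV[R]_(n i)) : block i (upd x u) = u.
Proof. by rewrite /block /upd mxrowK eqtype.dfwith_in. Qed.

Lemma block_upd_neq x i j (u : 'rV[R]_(n i)) : i != j ->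
  block j (upd x u) = block j x.
Proof. by move=> ij; rewrite /block /upd mxrowK eqtype.dfwith_out. Qed.

Lemma upd_block x i : upd x (block i x) = x.
Proof.
apply: profileP => j; have [<-|ij] := eqVneq i j; first by rewrite block_upd.
by rewrite block_upd_neq.
Qed.

Lemma upd_upd x i (u v : 'rV[R]_(n i)) : upd (upd x u) v = upd x v.
Proof.
apply: profileP => j; have [<-|ij] := eqVneq i j; first by rewrite !block_upd.
by rewrite !block_upd_neq.
Qed.

Lemma profiles_upd (X : forall i, set 'rV[R]_(n i)) x i (u : 'rV[R]_(n i)) :
  profiles X x -> X i u -> profiles X (upd x u).
Proof.
move=> Xx Xu j; have [<-|ij] := eqVneq i j; first by rewrite block_upd.
by rewrite block_upd_neq.
Qed.

Lemma blockD i x y : block i (x + y) = block i x + block i y.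
Proof. exact: submxrowD. Qed.

Lemma blockB i x y : block i (x - y) = block i x - block i y.
Proof. exact: submxrowB. Qed.

Lemma blockZ i (t : R) x : block i (t *: x) = t *: block i x.
Proof. by apply/matrixP => a c; rewrite !mxE. Qed.

Lemma profiles_convex (X : forall i, set 'rV[R]_(n i)) x y (t : R) :
  (forall i, convex_set (@X i)) -> profiles X x -> profiles X y ->
  0 <= t <= 1 -> profiles X (y + t *: (x - y)).
Proof.
move=> cX Xx Xy t01 i; rewrite blockD blockZ blockB.
have -> : block i y + t *: (block i x - block i y) =
    t *: block i x + (1 - t) *: block i y.
  by rewrite scalerBr scalerBl scale1r addrCA addrA addrAC.
exact: convex_setP.
Qed.

Lemma sum_profile (F : 'I_(\sum_i n i) -> R) :
  \sum_s F s = \sum_i \sum_(k < n i) F (tagnat.Rank i k).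
Proof.
rewrite (sig_big_dep _ _ (fun i k => F (tagnat.Rank i k))) /=.
rewrite (reindex _ tagnat.sig_bij_on) /=; apply: eq_bigr => s _.
by rewrite -[in LHS](tagnat.sig2K s).
Qed.

Lemma blockE i x k : block i x 0 k = x 0 (tagnat.Rank i k).
Proof. by rewrite mxE. Qed.

Lemma dot_blocks x y : dot x y = \sum_i dot (block i x) (block i y).
Proof.
rewrite /dot big_ord1 (sum_profile (fun s => x 0 s * y 0 s)).
by apply: eq_bigr => i _; rewrite big_ord1; apply: eq_bigr => k _; rewrite !blockE.
Qed.

Lemma enorm_block_le i x : enorm (block i x) <= enorm x.
Proof.
rewrite -ler_sqr ?nnegrE ?enorm_ge0 // !enorm_sqr (dot_blocks x) (bigD1 i) //=.
by rewrite lerDl sumr_ge0 // => j _; exact: dotvv_ge0.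
Qed.

Lemma derive_blocks (f : profile -> R) x v : differentiable f x ->
  'D_v f x = \sum_i dot (grad i f x) (block i v).
Proof.
move=> df; rewrite deriveE // [in LHS](row_sum_delta v) linear_sum /=.
under eq_bigr do rewrite linearZ /=.
rewrite (sum_profile (fun s => v 0 s *: 'd f x (delta_mx 0 s))).
apply: eq_bigr => i _; rewrite /dot big_ord1; apply: eq_bigr => k _.
by rewrite mxE deriveE // mulrC -blockE.
Qed.

Lemma derive_block (f : profile -> R) x i (u v : 'rV[R]_(n i)) :
  differentiable f x ->
  'D_(upd x u - upd x v) f x = dot (grad i f x) (u - v).
Proof.
move=> df; rewrite derive_blocks // (bigD1 i) //= blockB !block_upd big1 ?addr0 //.
by move=> j ji; rewrite blockB !block_upd_neq 1?eq_sym // subrr dot0r.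
Qed.

End ProfileAlgebra.

(** Both derivatives are limits of literally the same difference quotient, so derivability in the
    single direction v suffices. *)
Lemma is_derive_line (R : realType) (V : normedModType R) (g : V -> R)
    (p v : V) (t l : R) :
  is_derive (p + t *: v) v g l -> is_derive t (1 : R) (fun s => g (p + s *: v)) l.
Proof.
move=> [dg gl].
have E : (fun h : R => h^-1 *: (((fun s => g (p + s *: v)) \o shift t) (h *: (1 : R)) - g (p + t *: v)))
       = (fun h : R => h^-1 *: ((g \o shift (p + t *: v)) (h *: v) - g (p + t *: v))).
  apply/funext => h /=; congr (_ *: (g _ - _)).
  by rewrite /shift/= [h%:A]mulr1 scalerDl addrCA.
by split; [rewrite /derivable E|rewrite /derive E].
Qed.

Section GradientMonotonicity.
Context {R : realType} {N : nat} {n : 'I_N -> nat}.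
Local Notation profile := ('rV[R]_(\sum_i n i)).
Variables (X : forall i, set 'rV[R]_(n i)) (f : profile -> R) (i : 'I_N).
Hypothesis cX : forall i, convex_set (@X i).
Hypothesis df2 : forall x, profiles X x -> twice_differentiable f x.

Lemma profile_differentiable x : profiles X x -> differentiable f x.
Proof. by move=> /df2[h _]; exact: nbhs_singleton h. Qed.

(** The scalar mean value theorem is applied to t |-> <w, grad f (p' + t (p - p'))>. Fixing w
    beforehand yields one intermediate point q for all coordinates of the gradient at once. *)
Lemma grad_mvt (p p' : profile) (w : 'rV[R]_(n i)) :
  profiles X p -> profiles X p' ->
  exists2 q, profiles X q &
    dot (grad i f p - grad i f p') w =
    \sum_j dot (w *m hess i j f q) (block j (p - p')).
Proof.
move=> Xp Xp'.
pose phi (t : R) := \sum_k w 0 k * 'D_(unit_vec k) f (p' + t *: (p - p')).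
pose dphi (t : R) := \sum_k w 0 k *
  'D_(p - p') ('D_(unit_vec k) f) (p' + t *: (p - p')).
have dphiP (t : R) : 0 <= t <= 1 -> is_derive t (1 : R) phi (dphi t).
  move=> t01; have Xt := profiles_convex cX Xp Xp' t01.
  have -> : phi = \sum_k (w 0 k \*: (fun t => 'D_(unit_vec k) f (p' + t *: (p - p')))).
    by apply/funext => s; rewrite fct_sumE.
  apply: is_derive_sum => k; apply: is_deriveZ.
  apply: (@is_derive_line _ _ ('D_(unit_vec k) f) p' (p - p') t).
  by apply: derivableP; apply: diff_derivable; have [_] := df2 Xt; exact.
have cphi : {within `[0, 1], continuous phi}.
  apply: derivable_within_continuous => t; rewrite in_itv/= => t01.
  exact: (ex_derive (is_derive := dphiP t t01)).
have dphi01 (t : R) : t \in `]0, 1[%R -> is_derive t (1 : R) phi (dphi t).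
  by rewrite in_itv/= => /andP[t0 t1]; apply: dphiP; rewrite !ltW.
have [t] := MVT ltr01 dphi01 cphi; rewrite in_itv/= => /andP[t0 t1].
rewrite subr0 mulr1 => E.
have Xt : profiles X (p' + t *: (p - p')) by apply: profiles_convex => //; rewrite !ltW.
exists (p' + t *: (p - p')) => //.
have -> : dot (grad i f p - grad i f p') w = phi 1 - phi 0.
  rewrite dotBl /phi scale0r addr0 scale1r [p' + _]addrC subrK /dot !big_ord1.
  by congr (_ - _); apply: eq_bigr => k _; rewrite mxE mulrC.
rewrite E /dphi.
set q := p' + _.
have -> : \sum_k w 0 k * 'D_(p - p') ('D_(unit_vec k) f) q =
    \sum_k \sum_j w 0 k * dot (grad j ('D_(unit_vec k) f) q) (block j (p - p')).
  apply: eq_bigr => k _; rewrite derive_blocks ?mulr_sumr //.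
  by have [_] := df2 Xt; exact.
rewrite [LHS]exchange_big /=; apply: eq_bigr => j _; rewrite -dot_mulmx_tr.
rewrite /dot big_ord1; apply: eq_bigr => k _; rewrite big_ord1 mxE; congr (_ * _).
by apply: eq_bigr => l _; rewrite !mxE mulrC.
Qed.

Variables (z : R) (L : 'I_N -> R).
Hypothesis hz : forall x, profiles X x -> z <= lambda_min (hess i i f x).
Hypothesis hL : forall j x, j != i -> profiles X x ->
  spectral_norm (hess i j f x) <= L j.

(** Taking w to be the i-th block of p - p' turns the diagonal term of [grad_mvt] into a quadratic
    form, bounded below by the smallest eigenvalue; the other terms are bounded by spectral
    norms. *)
Lemma grad_monotone (p p' : profile) : profiles X p -> profiles X p' ->
  z * enorm (block i (p - p')) ^+ 2
    - enorm (block i (p - p')) * (\sum_(j | j != i) L j * enorm (block j (p - p')))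
  <= dot (grad i f p - grad i f p') (block i (p - p')).
Proof.
move=> Xp Xp'; have [q Xq ->] := grad_mvt (block i (p - p')) Xp Xp'.
rewrite [leRHS](bigD1 i) //=; apply: lerD.
  rewrite dotC; apply: le_trans (lambda_min_le _ _).
  by rewrite ler_wpM2r ?sqr_ge0 // hz.
rewrite lerNl -sumrN mulr_sumr; apply: ler_sum => j ji.
rewrite -dotNr (le_trans (ler_norm _)) // (le_trans (dot_spectral_norm _ _ _)) //.
rewrite enormN [leRHS]mulrCA [leRHS]mulrA.
by do 2 rewrite ler_wpM2r ?enorm_ge0 //; exact: hL.
Qed.

(** First-order optimality along the segment from u to v. Only f is differentiated; the proximal
    term is expanded exactly and leaves a remainder of order h. *)
Lemma prox_vi (mu : R) (y : profile) (c u v : 'rV[R]_(n i)) : 0 <= mu ->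
  profiles X y -> @X i u -> @X i v ->
  (forall v, @X i v -> f (upd y u) + mu / 2 * enorm (u - c) ^+ 2 <=
                     f (upd y v) + mu / 2 * enorm (v - c) ^+ 2) ->
  0 <= dot (grad i f (upd y u) + mu *: (u - c)) (v - u).
Proof.
move=> mu0 Xy Xu Xv umin; rewrite dotDl dotZl.
set e := v - u; set s := dot (u - c) e.
have Xyu := profiles_upd Xy Xu.
have dfu : differentiable f (upd y u) by exact: profile_differentiable.
rewrite -(derive_block (i := i)) // !upd_upd.
have := diff_derivable (v := upd y v - upd y u) dfu; rewrite /derivable /derive /=.
set g := (fun h : R => _ *: _); move=> cvg_g; set l := lim _.
rewrite leNgt; apply/negP => neg.
pose q := enorm e ^+ 2.
have q0 : 0 <= q by exact: sqr_ge0.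
have key (h : R) : 0 < h -> h <= 1 -> - (mu * s) - h * (mu / 2 * q) <= g h.
  move=> h0 h1; rewrite /g /=.
  have -> : h *: (upd y v - upd y u) + upd y u = upd y (u + h *: e).
    apply: profileP => j; rewrite blockD blockZ blockB.
    have [<-|ij] := eqVneq i j; first by rewrite !block_upd addrC.
    by rewrite !block_upd_neq // subrr scaler0 add0r.
  have Xh : @X i (u + h *: e).
    have -> : u + h *: e = h *: v + (1 - h) *: u.
      by rewrite /e scalerBr scalerBl scale1r addrCA addrA addrAC.
    by apply: convex_setP => //; rewrite h1 ltW.
  have := umin _ Xh.
  have -> : u + h *: e - c = (u - c) + h *: e by rewrite addrAC.
  rewrite (enorm_sqrD (u - c)) dotZr enormZ exprMn real_normK ?num_real // -/s -/q => H.
  rewrite /GRing.scale/= [leRHS]mulrC ler_pdivlMr //.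
  by rewrite mulrBl -[h * _ * _]mulrA; nra.
have /cvgrPdist_lt H : g @ 0^' --> l by exact: cvg_g.
(* Half of the supposed deficit: one half is spent on the distance from g h to its limit, the other
   on the quadratic remainder. *)
pose eps := - (l + mu * s) / 2.
have eps0 : 0 < eps by rewrite /eps divr_gt0 // oppr_gt0.
have [r /= r0 Hr] := H _ eps0.
(* The three bounds put h inside the neighbourhood of the limit, keep u + h e on the segment, and
   make the remainder smaller than eps. *)
pose h := Num.min (r / 2) (Num.min 1 (eps / (mu / 2 * q + 1))).
have mq : 0 <= mu / 2 * q by rewrite mulr_ge0 // divr_ge0.
have h0 : 0 < h by rewrite !lt_min ltr01 (divr_gt0 r0) //= (divr_gt0 eps0) // ltr_wpDl.
have h1 : h <= 1 by rewrite /h !ge_min lexx !orbT.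
have hr : h < r.
  by rewrite (@le_lt_trans _ _ (r / 2)) ?ge_min ?lexx // ltr_pdivrMr // ltr_pMr // ltr1n.
have he : h * (mu / 2 * q + 1) <= eps.
  by rewrite -ler_pdivlMr ?(ltr_wpDl mq) // /h !ge_min lexx !orbT.
have := Hr h; rewrite /ball_/= sub0r normrN (gtr0_norm h0) => /(_ hr (lt0r_neq0 h0)).
rewrite distrC => /(le_lt_trans (ler_norm _)).
by have := key h h0 h1; rewrite /eps in he *; nra.
Qed.

End GradientMonotonicity.

(** * Proximal best responses *)

(** The two variational inequalities add up to <g - g', u - v> + mu |u - v|^2 <= mu <c - c', u - v>;
    a factor |u - v| then cancels. S stands for the coupling with the rivals. *)
Lemma vi_contraction (R : realType) n (mu z S : R) (g g' u v c c' : 'rV[R]_n) :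
  0 <= mu -> 0 <= S ->
  0 <= dot (g + mu *: (u - c)) (v - u) ->
  0 <= dot (g' + mu *: (v - c')) (u - v) ->
  z * enorm (u - v) ^+ 2 - enorm (u - v) * S <= dot (g - g') (u - v) ->
  (mu + z) * enorm (u - v) <= mu * enorm (c - c') + S.
Proof.
move=> mu0 S0; have CS := dot_le (c - c') (u - v).
have : enorm (u - v) ^+ 2 = dot u (u - v) - dot v (u - v) by rewrite enorm_sqr dotBl.
rewrite -(opprB u v) dotNr; move: CS.
rewrite !(dotDl, dotNl, dotZl); move: (u - v) => w CS ww H1 H2 H3.
have [w0|w0] := eqVneq (enorm w) 0.
  by rewrite w0 mulr0 addr_ge0 ?mulr_ge0 ?enorm_ge0.
have wp : 0 < enorm w by rewrite lt_neqAle eq_sym w0 enorm_ge0.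
rewrite -(ler_pM2l wp).
have {}CS := ler_wpM2l mu0 CS.
suff : (mu + z) * enorm w ^+ 2 <= mu * (dot c w - dot c' w) + enorm w * S by nra.
have : mu * enorm w ^+ 2 = mu * (dot u w - dot v w) by rewrite ww.
lra.
Qed.

Section BestResponse.
Context {R : realType} {d : measure_display} {Omega : measurableType d}.
Context {N m : nat} {n : 'I_N -> nat}.
Local Notation profile := ('rV[R]_(\sum_i n i)).
Variables (P : probability Omega R) (xi : Omega -> 'rV[R]_m).
Variables (X : forall i, set 'rV[R]_(n i)).
Variables (psi : 'I_N -> profile -> 'rV[R]_m -> R) (M : 'I_N -> R).
Hypothesis hA : assumptionA P xi X psi M.
Hypothesis hD : assumptionD P xi X psi.
Variables (mu : R) (xref : profile).
Hypothesis mu_gt0 : 0 < mu.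
Hypothesis Xref : profiles X xref.

Local Notation f := (cost P xi psi).
Local Notation zmin i := (fine (zeta_min P xi X psi i)).
Local Notation zmax i j := (fine (zeta_max P xi X psi i j)).
Local Notation G := (Gamma P xi X psi mu).
Local Notation a := (infty_norm G).
Local Notation br := (prox_br P xi X psi mu).

Let cX := A_convex hA.

Lemma zeta_max_ge0 i j : (0 <= zeta_max P xi X psi i j)%E.
Proof.
apply: le_trans (ereal_sup_ubound _); last by exists xref.
by rewrite lee_fin spectral_norm_ge0.
Qed.

(** Assumption D puts the infimum above a sum of nonnegative terms, and the feasible profile [xref]
    puts it below +oo. Each [zeta_max] is then finite as a term of a sum below a finite number. *)
Lemma zeta_min_fin i : zeta_min P xi X psi i = (zmin i)%:E.
Proof.
rewrite fineK // fin_numElt; apply/andP; split.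
  apply: (@lt_le_trans _ _ 0%E) => //; apply: le_trans (ltW (hD i)).
  by apply: sume_ge0 => j _; exact: zeta_max_ge0.
apply: le_lt_trans (ereal_inf_lbound _) (ltry _); first by exists xref.
Qed.

Lemma zeta_max_fin i j : j != i -> zeta_max P xi X psi i j = (zmax i j)%:E.
Proof.
move=> ji; rewrite fineK // ge0_fin_numE ?zeta_max_ge0 //.
apply: (@le_lt_trans _ _ (\sum_(j | j != i) zeta_max P xi X psi i j)%E).
  rewrite (bigD1 j) //= leeDl // sume_ge0 // => k _; exact: zeta_max_ge0.
by apply: (lt_trans (hD i)); rewrite zeta_min_fin ltry.
Qed.

Lemma zmax_ge0 i j : 0 <= zmax i j.
Proof. exact/fine_ge0/zeta_max_ge0. Qed.

Lemma sum_zmax_lt i : \sum_(j | j != i) zmax i j < zmin i.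
Proof.
rewrite -lte_fin -zeta_min_fin -sumEFin (le_lt_trans _ (hD i)) //.
by apply: lee_sum => j ji; rewrite -zeta_max_fin.
Qed.

Lemma zmin_gt0 i : 0 < zmin i.
Proof.
by apply: le_lt_trans (sum_zmax_lt i); apply: sumr_ge0 => j _; exact: zmax_ge0.
Qed.

Lemma zmin_le i x : profiles X x -> zmin i <= lambda_min (hess i i (f i) x).
Proof.
by move=> Xx; rewrite -lee_fin -zeta_min_fin; apply: ereal_inf_lbound; exists x.
Qed.

Lemma zmax_ge i j x : j != i -> profiles X x ->
  spectral_norm (hess i j (f i) x) <= zmax i j.
Proof.
by move=> ji Xx; rewrite -lee_fin -zeta_max_fin //; apply: ereal_sup_ubound; exists x.
Qed.

Lemma Gamma_ge0 i j : 0 <= G i j.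
Proof.
rewrite mxE divr_ge0 //; last by rewrite addr_ge0 ?ltW // zmin_gt0.
by case: ifP => _; [exact: ltW|exact: zmax_ge0].
Qed.

Lemma Gamma_row_sum i : \sum_j G i j <= a.
Proof.
rewrite /infty_norm; apply: le_trans (le_bigmax _ (fun i => \sum_j `|G i j|) i).
by apply: ler_sum => j _; exact: ler_norm.
Qed.

Lemma infty_norm_ge0 : 0 <= a.
Proof.
rewrite /infty_norm; elim/big_rec: _ => // i y _ y0.
by rewrite le_max y0 orbT.
Qed.

Lemma infty_norm_Gamma_lt1 : a < 1.
Proof.
rewrite /infty_norm; apply: bigmax_lt => // i _.
under eq_bigr => j _ do rewrite ger0_norm ?Gamma_ge0 //.
rewrite (bigD1 i) //=; have z0 := zmin_gt0 i.
under eq_bigr => j ji do rewrite mxE eq_sym (negbTE ji).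
by rewrite mxE eqxx -mulr_suml -mulrDl ltr_pdivrMr ?addr_gt0 // mul1r ltrD2l sum_zmax_lt.
Qed.

Lemma prox_br_min i y : profiles X y ->
  X (br i y) /\
  forall v, @X i v -> f i (upd y (br i y)) + mu / 2 * enorm (br i y - block i y) ^+ 2
                   <= f i (upd y v) + mu / 2 * enorm (v - block i y) ^+ 2.
Proof.
move=> Xy; apply: argmin_spec; [by exists (block i y); exact: Xy|exact: A_compact hA i|].
apply: continuous_in_subspaceT => u; rewrite inE => Xu.
have [U [_ XU _ _ C2]] := A_C2 hA i Xy; have [du _ _] := C2 _ (XU _ Xu).
apply: (@continuousD _ _ _ (fun w => f i (upd y w))
  (fun w : 'rV[R]_(n i) => mu / 2 * enorm (w - block i y) ^+ 2)).
  exact: differentiable_continuous.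
apply: (@continuousM _ _ (fun=> mu / 2)
  (fun w : 'rV[R]_(n i) => enorm (w - block i y) ^+ 2)); first exact: cst_continuous.
apply: (@continuous_comp _ _ _ (fun w : 'rV[R]_(n i) => enorm (w - block i y)) (fun x => x ^+ 2)).
  exact: enormB_continuous.
exact: exprn_continuous.
Qed.

Lemma prox_br_vi i y v : profiles X y -> @X i v ->
  0 <= dot (grad i (f i) (upd y (br i y)) + mu *: (br i y - block i y)) (v - br i y).
Proof.
move=> Xy Xv; have [Xb bmin] := prox_br_min i Xy.
exact: (prox_vi cX (@A_twice _ _ _ _ _ _ _ _ _ _ _ hA i) (ltW mu_gt0) Xy Xb Xv bmin).
Qed.

Lemma cost_grad_monotone i p p' : profiles X p -> profiles X p' ->
  zmin i * enorm (block i (p - p')) ^+ 2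
    - enorm (block i (p - p')) * (\sum_(j | j != i) zmax i j * enorm (block j (p - p')))
  <= dot (grad i (f i) p - grad i (f i) p') (block i (p - p')).
Proof.
apply: (grad_monotone cX (@A_twice _ _ _ _ _ _ _ _ _ _ _ hA i)) => //.
  by move=> x; exact: zmin_le.
by move=> j x; exact: zmax_ge.
Qed.

(** The profiles compared differ in block i only, so the coupling terms vanish. The proximal term
    supplies the modulus mu that the step sizes 1 / (mu (t + 1)) are tuned to; the nonnegative
    [zmin] part is dropped. *)
Lemma prox_grad_monotone i y v : profiles X y -> @X i v ->
  mu * enorm (v - br i y) ^+ 2
  <= dot (grad i (f i) (upd y v) + mu *: (v - block i y)) (v - br i y).
Proof.
move=> Xy Xv; have [Xb _] := prox_br_min i Xy.
have := cost_grad_monotone i (profiles_upd Xy Xv) (profiles_upd Xy Xb).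
rewrite blockB !block_upd big1 ?mulr0 ?subr0; last first.
  by move=> j ji; rewrite blockB !block_upd_neq 1?eq_sym // subrr enorm0 mulr0.
have := prox_br_vi Xy Xv; move eE : (v - br i y) => e.
have -> : v - block i y = (br i y - block i y) + e by rewrite -eE [RHS]addrC subrKA.
rewrite !(dotDl, dotNl, dotZl) -enorm_sqr => H1 H2.
have : 0 <= zmin i * enorm e ^+ 2 by rewrite mulr_ge0 ?sqr_ge0 // ltW // zmin_gt0.
nra.
Qed.

Lemma prox_br_contraction i y y' : profiles X y -> profiles X y' ->
  enorm (br i y - br i y') <= \sum_j G i j * enorm (block j y - block j y').
Proof.
move=> Xy Xy'; have [Xb _] := prox_br_min i Xy; have [Xb' _] := prox_br_min i Xy'.
have z0 := zmin_gt0 i; have mz0 : 0 < mu + zmin i by rewrite addr_gt0.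
have -> : \sum_j G i j * enorm (block j y - block j y') =
    (mu * enorm (block i y - block i y') +
     \sum_(j | j != i) zmax i j * enorm (block j y - block j y')) / (mu + zmin i).
  rewrite (bigD1 i) //= mxE eqxx mulrAC mulrDl; congr (_ + _).
  rewrite mulr_suml; apply: eq_bigr => j ji.
  by rewrite mxE eq_sym (negbTE ji) mulrAC.
rewrite ler_pdivlMr // mulrC.
have := cost_grad_monotone i (profiles_upd Xy Xb) (profiles_upd Xy' Xb').
have -> : \sum_(j | j != i) zmax i j * enorm (block j (upd y (br i y) - upd y' (br i y'))) =
    \sum_(j | j != i) zmax i j * enorm (block j y - block j y').
  apply: eq_bigr => j ji; rewrite blockB block_upd_neq 1?eq_sym //.
  by rewrite block_upd_neq 1?eq_sym.
rewrite blockB block_upd block_upd.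
apply: vi_contraction (prox_br_vi Xy Xb') (prox_br_vi Xy' Xb) => //; first exact: ltW.
by apply: sumr_ge0 => j _; rewrite mulr_ge0 ?enorm_ge0 ?zmax_ge0.
Qed.

(** Minimality of the best response, tested at the equilibrium strategy, and the Nash inequality,
    tested at the best response, cancel the costs and leave mu / 2 |.|^2 <= 0. *)
Lemma nash_prox_br xs i : nash P xi X psi xs -> br i xs = block i xs.
Proof.
move=> [Xs smin]; have [Xb bmin] := prox_br_min i Xs.
have := bmin _ (Xs i); rewrite subrr enorm0 expr0n mulr0 addr0 upd_block => h.
have := smin i _ Xb => h2.
have h3 : mu / 2 * enorm (br i xs - block i xs) ^+ 2 <= 0 by lra.
apply/subr0_eq/enorm_eq0/eqP; rewrite -sqrf_eq0 eq_le sqr_ge0 andbT.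
by rewrite pmulr_rle0 // divr_gt0 in h3.
Qed.

Lemma prox_br_nash xs i y : nash P xi X psi xs -> profiles X y ->
  enorm (br i y - block i xs) <= \sum_j G i j * enorm (block j y - block j xs).
Proof.
move=> hs Xy; have [Xs _] := hs.
by rewrite -{1}(nash_prox_br i hs); exact: prox_br_contraction.
Qed.

End BestResponse.

(** * Measurability and freezing of independent variables *)

Section BorelVectors.
Context {R : realType}.

(** Second countability of the product, with cubes of rational centre and radius 1 / (j + 1). It
    lets coordinatewise measurability reach the Borel sets of pairs in which [A_measurable] is
    phrased. *)
Lemma open_pair_rational n p (O : set ('rV[R]_n * 'rV[R]_p)) :
  open O ->
  let I := ('rV[rat]_n * 'rV[rat]_p * nat)%type in
  let cube (c : I) := [set xy : 'rV[R]_n * 'rV[R]_p |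
    (forall k, `|xy.1 0 k - ratr (c.1.1 0 k)| < c.2.+1%:R^-1) /\
    (forall k, `|xy.2 0 k - ratr (c.1.2 0 k)| < c.2.+1%:R^-1)] in
  O = \bigcup_(c in [set c : I | cube c `<=` O]) cube c.
Proof.
move=> oO I cube; apply/seteqP; split => [[x y] Oxy|xy [c /= cO cxy]]; last exact: cO.
have /nbhs_ballP[e /= e0 eO] : nbhs (x, y) O by exact: open_nbhs_nbhs.
have [j je] : exists j : nat, j.+1%:R^-1 < e / 2.
  exists (Num.truncn (e / 2)^-1); rewrite invf_plt ?posrE ?divr_gt0 //.
  by have := truncnS_gt (e / 2)^-1.
have dens q (v : 'rV[R]_q) : exists r : 'rV[rat]_q,
    forall k, `|v 0 k - ratr (r 0 k)| < j.+1%:R^-1.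
  have h k : exists r : rat, `|v 0 k - ratr r| < j.+1%:R^-1.
    have /rat_in_itvoo[r] : v 0 k < v 0 k + j.+1%:R^-1 by rewrite ltrDl invr_gt0.
    rewrite in_itv/= => /andP[r1 r2]; exists r.
    by rewrite distrC ger0_norm ?subr_ge0 ?ltW // ltrBlDl.
  exists (\row_k sval (cid (h k))) => k; rewrite mxE; exact: (svalP (cid (h k))).
have [r1 h1] := dens _ x; have [r2 h2] := dens _ y.
exists (r1, r2, j) => //= -[x' y'] [/= h1' h2']; apply: eO; split => /=.
  split=> // i k; rewrite !ord1 /ball /=.
  have -> : x 0 k - x' 0 k = (x 0 k - ratr (r1 0 k)) - (x' 0 k - ratr (r1 0 k)) by ring.
  rewrite (le_lt_trans (ler_normB _ _)) //.
  by rewrite [ltRHS]splitr; apply: ltrD; exact: lt_trans je.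
split=> // i k; rewrite !ord1 /ball /=.
have -> : y 0 k - y' 0 k = (y 0 k - ratr (r2 0 k)) - (y' 0 k - ratr (r2 0 k)) by ring.
rewrite (le_lt_trans (ler_normB _ _)) //.
by rewrite [ltRHS]splitr; apply: ltrD; exact: lt_trans je.
Qed.

Lemma borel_preimage d (T : measurableType d) (S : topologicalType) (f : T -> S) :
  (forall O, open O -> measurable (f @^-1` O)) ->
  forall B, borel B -> measurable (f @^-1` B).
Proof.
move=> fO B bB.
suff : image_set_system setT f (@measurable _ T) B by rewrite /image_set_system/= setTI.
apply: (smallest_sub _ _ bB).
  exact/sigma_algebra_image/sigma_algebra_measurable.
by move=> O oO; rewrite /image_set_system/= setTI; exact: fO.
Qed.

Lemma borel_continuous (S S' : topologicalType) (f : S -> S') B :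
  continuous f -> borel B -> borel (f @^-1` B).
Proof.
move=> cf bB.
suff : image_set_system setT f (@borel S) B by rewrite /image_set_system/= setTI.
apply: (smallest_sub _ _ bB); first exact/sigma_algebra_image/smallest_sigma_algebra.
move=> O oO; rewrite /image_set_system/= setTI; apply: sub_sigma_algebra.
by apply: open_comp => // x _; exact: cf.
Qed.

Section Closure.
Context d (T : measurableType d).

(** The sigma-algebra is that of T, so the same closure lemmas serve the whole space, the past of a
    gradient step and product spaces. *)
Definition meas_rv n (f : T -> 'rV[R]_n) :=
  forall k, measurable_fun setT (fun w => f w 0 k).

Lemma meas_rv_pair n p (f : T -> 'rV[R]_n) (g : T -> 'rV[R]_p) B :
  meas_rv f -> meas_rv g -> borel B ->
  measurable ((fun w => (f w, g w)) @^-1` B).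
Proof.
move=> mf mg; move: B; apply: borel_preimage => O oO.
rewrite (open_pair_rational oO) preimage_bigcup.
have mcube q (h : T -> 'rV[R]_q) (r : 'rV[rat]_q) (e : R) : meas_rv h ->
    measurable [set w | forall k, `|h w 0 k - ratr (r 0 k)| < e].
  move=> mh.
  have -> : [set w | forall k, `|h w 0 k - ratr (r 0 k)| < e] =
      \bigcap_(k in [set: 'I_q]) [set w | `|h w 0 k - ratr (r 0 k)| < e].
    by apply/seteqP; split => w /= hw k; [move=> _|]; exact: hw.
  apply: fin_bigcap_measurable => // k _.
  have -> : [set w | `|h w 0 k - ratr (r 0 k)| < e] =
      setT `&` (fun w => `|h w 0 k - ratr (r 0 k)|) @^-1` `]-oo, e[.
    by rewrite setTI; apply/seteqP; split => w /=; rewrite in_itv.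
  have mfk : measurable_fun setT (fun w => `|h w 0 k - ratr (r 0 k)|).
    by apply: measurableT_comp => //; exact: measurable_funB.
  exact: mfk.
rewrite bigcup_mkcond; apply: countable_bigcupT_measurable => [|c].
  exact: countableP.
case: ifP => _ //.
exact: measurableI (mcube _ f c.1.1 c.2.+1%:R^-1 mf) (mcube _ g c.1.2 c.2.+1%:R^-1 mg).
Qed.

Lemma meas_rv_borel n (f : T -> 'rV[R]_n) B : meas_rv f -> borel B ->
  measurable (f @^-1` B).
Proof.
move=> mf bB.
have := meas_rv_pair (B := fst @^-1` B) mf mf; apply.
by apply: borel_continuous => // -[x y]; exact: cvg_fst.
Qed.

Lemma borel_meas_rv n (f : T -> 'rV[R]_n) :
  (forall O, open O -> measurable (f @^-1` O)) -> meas_rv f.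
Proof.
move=> mf k; apply: (measurability _ (RGenOpens.measurableE R)) => _ [_ [a [b ->]] <-].
rewrite setTI; apply: (mf ((fun v : 'rV[R]_n => v 0 k) @^-1` `]a, b[%classic)).
apply: open_comp; last exact: interval_open.
by move=> v _; exact: coord_continuous.
Qed.

(** Continuity within A makes the preimage of an open set the trace on A of an open V, and f cannot
    leave A. Best responses are controlled only on feasible profiles, hence this relative form. *)
Lemma meas_rv_within n p (f : T -> 'rV[R]_n) (g : 'rV[R]_n -> 'rV[R]_p) A :
  {within A, continuous g} -> (forall w, A (f w)) -> meas_rv f -> meas_rv (g \o f).
Proof.
move=> cg Af mf; apply: borel_meas_rv => O oO.
have := (continuousP (g : subspace A -> _)).1 cg _ oO; rewrite open_subspaceP => -[V oV VA].
have -> : (g \o f) @^-1` O = f @^-1` V.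
  apply/seteqP; split => w /= h.
    have : (g @^-1` O `&` A) (f w) by [].
    by rewrite -VA => -[].
  have : (V `&` A) (f w) by [].
  by rewrite VA => -[].
by apply: meas_rv_borel => //; exact: sub_sigma_algebra.
Qed.

Lemma meas_rvD n (f g : T -> 'rV[R]_n) : meas_rv f -> meas_rv g ->
  meas_rv (fun w => f w + g w).
Proof.
move=> mf mg k; under eq_fun do rewrite mxE; exact: measurable_funD.
Qed.

Lemma meas_rvZ n (c : R) (f : T -> 'rV[R]_n) : meas_rv f ->
  meas_rv (fun w => c *: f w).
Proof.
move=> mf k; under eq_fun do rewrite mxE; exact: measurable_funM.
Qed.

Lemma meas_rvB n (f g : T -> 'rV[R]_n) : meas_rv f -> meas_rv g ->
  meas_rv (fun w => f w - g w).
Proof.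
move=> mf mg k; under eq_fun do rewrite !mxE; exact: measurable_funB.
Qed.

Lemma meas_rv_cst n (v : 'rV[R]_n) : meas_rv (cst v).
Proof. by move=> k; exact: measurable_cst. Qed.

Lemma meas_enorm n (f : T -> 'rV[R]_n) : meas_rv f ->
  measurable_fun setT (fun w => enorm (f w)).
Proof.
move=> mf; apply: (@measurableT_comp _ _ _ _ _ _ (@Num.sqrt R)).
  by apply: continuous_measurable_fun; exact: sqrt_continuous.
apply: measurable_sum => i; apply: measurable_sum => j; rewrite ord1.
exact: measurable_funX.
Qed.

(** Partition along the countably many values of [tau]; this covers an iterate read with a random
    delay. *)
Lemma meas_rv_natcase n (tau : T -> nat) (f : nat -> T -> 'rV[R]_n) :
  (forall s, measurable (tau @^-1` [set s])) -> (forall s, meas_rv (f s)) ->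
  meas_rv (fun w => f (tau w) w).
Proof.
move=> mtau mf k _ B mB; rewrite setTI.
have -> : (fun w => f (tau w) w 0 k) @^-1` B =
    \bigcup_s (tau @^-1` [set s] `&` ((fun w => f s w 0 k) @^-1` B)).
  apply/seteqP; split => [w /= Bw|w [s _ [/= <-]]//].
  by exists (tau w).
apply: bigcupT_measurable => s; apply: measurableI => //.
by rewrite -[X in measurable X]setTI; exact: mf.
Qed.

End Closure.
End BorelVectors.

(** * Independence and integration over a fresh sample *)

Section Freezing.
Context {R : realType} {d : measure_display} {Omega : measurableType d}.
Variable P : probability Omega R.

Lemma sigma_algebra_sub (gen : set (set Omega)) : gen `<=` measurable ->
  <<s gen >> `<=` (measurable : set (set Omega)).
Proof. by move=> h; apply: smallest_sub => //; exact: sigma_algebra_measurable. Qed.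

Lemma setT_sigma (gen : set (set Omega)) : <<s gen >> setT.
Proof. exact: (@measurableT _ (g_sigma_algebraType gen)). Qed.

Lemma setI_sigma (gen : set (set Omega)) A B :
  <<s gen >> A -> <<s gen >> B -> <<s gen >> (A `&` B).
Proof. exact: (@measurableI _ (g_sigma_algebraType gen)). Qed.

Lemma independentC (G H : set (set Omega)) :
  independent P G H -> independent P H G.
Proof. by move=> GH A B HA GB; rewrite setIC muleC GH. Qed.

(** For fixed A the finite measures C |-> P (A [&] C) and P A * P agree on the pi-system H, hence on
    the sigma-algebra that it generates. *)
Lemma independent_g_sigma (G H : set (set Omega)) :
  G `<=` measurable -> H `<=` measurable -> setI_closed H -> H setT ->
  independent P G H -> independent P G <<s H >>.
Proof.
move=> mG mH HI HT GH A B GA sB; have mA := mG _ GA.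
pose m1 := mrestr P mA.
pose pA : {nonneg R} := NngNum (fine_ge0 (measure_ge0 P A)).
pose m2 := mscale pA P.
have cover : \bigcup_(k : nat) [set: Omega] = setT.
  by apply/seteqP; split => // w _; exists 0%N.
have m1E C : m1 C = P (A `&` C) by rewrite setIC.
have m2E C : m2 C = (P A * P C)%E.
  by rewrite -[P A]fineK ?fin_num_measure.
have m12 C : H C -> m1 C = m2 C by move=> HC; rewrite m1E m2E GH.
have m1oo (k : nat) : (m1 setT < +oo)%E.
  by rewrite m1E setIT -ge0_fin_numE // fin_num_measure.
rewrite -m1E -m2E.
exact: (@g_sigma_algebra_measure_unique _ _ _ H mH (fun=> setT) (fun=> HT) cover m1 m2 HI m12 m1oo).
Qed.

Variable (gen : set (set Omega)).
Hypothesis mgen : gen `<=` measurable.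
Variables (n : nat) (V xi : Omega -> 'rV[R]_n).
Hypotheses (mV : random_element V) (mxi : random_element xi).
Hypothesis V_law : same_law P V xi.
Hypothesis V_indep : independent P (sigma_of V) <<s gen >>.

Local Notation T1 := (g_sigma_algebraType gen).
Local Notation T2 := (g_sigma_algebraType [set A : set 'rV[R]_n | open A]).

(** Independence makes the law of w |-> (w, V w) a product law, and Tonelli integrates the second
    component alone. The first factor is Omega itself with the sigma-algebra of the past, so h may
    depend on the past through any measurable quantity. *)
Lemma freezing (h : T1 * T2 -> \bar R) :
  measurable_fun setT h -> (forall z, 0 <= h z)%E ->
  measurable_fun setT (fun w : Omega => \int[P]_w' h (w, xi w'))%E /\
  (\int[P]_w h (w, V w) = \int[P]_w \int[P]_w' h (w, xi w'))%E.
Proof.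
move=> mh h0.
have mid : measurable_fun setT (id : Omega -> T1).
  by move=> _ B mB; rewrite setTI preimage_id; exact: (sigma_algebra_sub mgen mB).
have mY (Y : Omega -> 'rV[R]_n) : random_element Y -> measurable_fun setT (Y : Omega -> T2).
  by move=> hY _ B mB; rewrite setTI; apply: hY; exists B.
have mpair : measurable_fun setT (fun w => (w, V w) : T1 * T2).
  by apply: measurable_fun_pair => //; exact: mY.
pose idM : {mfun Omega >-> T1} := HB.pack (id : Omega -> T1) (isMeasurableFun.Build _ _ _ _ _ mid).
pose xiM : {mfun Omega >-> T2} := HB.pack (xi : Omega -> T2) (isMeasurableFun.Build _ _ _ _ _ (mY _ mxi)).
pose phiM : {mfun Omega >-> (T1 * T2)%type} :=
  HB.pack (fun w => (w, V w) : T1 * T2) (isMeasurableFun.Build _ _ _ _ _ mpair).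
have prodE (C : set (T1 * T2)) : measurable C ->
    (distribution P idM \x distribution P xiM)%E C = distribution P phiM C.
  move=> mC; apply: product_measure_unique => // A B mA mB.
  suff PVA : P (V @^-1` B `&` A) = (P A * P (xi @^-1` B))%E.
    by rewrite -[RHS]PVA; congr (P _); apply/seteqP; split => w /= [].
  by rewrite V_indep //; [rewrite muleC V_law|exists B].
have FE (w : T1) : fubini_F (distribution P xiM) h w = (\int[P]_w' h (w, xi w'))%E.
  rewrite /fubini_F /= ge0_integral_distribution //.
  by apply: (measurableT_comp mh); exact: (@pair1_measurable _ _ T1 T2 w).
have mF : measurable_fun setT (fubini_F (distribution P xiM) h).
  exact: measurable_fun_fubini_tonelli_F.
split; first by under eq_fun do rewrite -FE; exact: measurableT_comp mF mid.
transitivity (\int[distribution P phiM]_z h z)%E.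
  by rewrite ge0_integral_distribution.
transitivity (\int[distribution P idM \x distribution P xiM]_z h z)%E.
  by apply: eq_measure_integral => C mC _; exact/esym/prodE.
rewrite fubini_tonelli1 // ge0_integral_distribution //; last first.
  by move=> w; exact: integral_ge0.
by apply: eq_integral => w _; rewrite /= FE.
Qed.

End Freezing.

(** * Conditional bounds from integrals over events *)

Section ConditionalExpectation.
Context {R : realType} {d : measure_display} {Omega : measurableType d}.
Variable P : probability Omega R.

(** The required version Z is the density of the charge A |-> \int_A Y with respect to P, both
    restricted to the sub-sigma-algebra. *)
Lemma cond_exp_le_of_integral (gen : set (set Omega)) (Y : Omega -> R) (b K : R) :
  gen `<=` measurable -> measurable_fun setT Y -> (forall w, 0 <= Y w <= K) ->
  (forall A, <<s gen >> A -> (\int[P]_(w in A) (Y w)%:E <= b%:E * P A)%E) ->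
  cond_exp_le P <<s gen >> Y b.
Proof.
move=> mgen mY Y0K Yb; pose T1 := g_sigma_algebraType gen.
have msub : <<s gen >> `<=` (measurable : set (set Omega)) by exact: sigma_algebra_sub.
have mid : measurable_fun setT (id : Omega -> T1).
  by move=> _ B mB; rewrite setTI preimage_id; exact: msub.
pose idM : {mfun Omega >-> T1} := HB.pack (id : Omega -> T1) (isMeasurableFun.Build _ _ _ _ _ mid).
have iY : P.-integrable setT (EFin \o Y).
  apply: measurable_bounded_integrable => //.
  - by apply: le_lt_trans (probability_le1 _ _) (ltry _).
  - exists K; split; first exact: num_real.
    by move=> x Kx w _ /=; case/andP: (Y0K w) => Y0 YK; rewrite ger0_norm // (le_trans YK) // ltW.
pose nu0 := induced_charge iY.
(* Pushing forward along the identity is the restriction to the coarser sigma-algebra, for which the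
   density has to be measurable. *)
pose nu := pushforward nu0 idM.
pose Pg := distribution P idM.
have dom : nu `<< Pg.
  apply: (dominates_pushforward mid).
  apply/null_content_dominatesP => A mA PA0; rewrite /nu0 /induced_charge.
  by apply: null_set_integral => //; exact/measurable_funTS/measurable_EFinP.
have [f [f_fin fi fE]] : exists f : T1 -> \bar R,
    [/\ forall x, f x \is a fin_num, Pg.-integrable setT f &
        forall A, measurable A -> (nu A = \int[Pg]_(x in A) f x)%E].
  eexists; split; first by move=> x; exact: (Radon_Nikodym_fin_num x dom).
    exact: (Radon_Nikodym_integrable dom).
  by move=> A mA; exact: (Radon_Nikodym_integral dom mA).
have mf : measurable_fun setT f := measurable_int _ fi.
pose Z w := fine (f w).
have ZE : EFin \o Z = f by apply/funext => w /=; rewrite /Z fineK.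
have fiP : P.-integrable setT f.
  apply/integrableP; split; first exact: measurableT_comp mf mid.
  move: fi => /integrableP[_]; rewrite ge0_integral_distribution //.
  by apply: measurableT_comp => //; exact: measurable_abse.
have fA A : <<s gen >> A -> (\int[P]_(w in A) f w = \int[P]_(w in A) (Y w)%:E)%E.
  move=> sA; transitivity (nu A) => //; rewrite fE // integral_pushforward //.
  exact: (integrableS measurableT (msub _ sA) (@subsetT _ _) fiP).
exists Z; [split|].
- move=> B mB.
  have : measurable_fun setT (Z : T1 -> R) by apply/measurable_EFinP; rewrite ZE.
  by move=> /(_ measurableT B mB); rewrite setTI.
- by rewrite ZE.
- by move=> A sA; rewrite -fA //; apply: eq_integral => w _; rewrite -ZE.
(* The assumed bound at this event gives \int_B (Z - b) <= 0 although the integrand is positive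
   there, so B is negligible. *)
pose B : set Omega := [set w | b < Z w].
have sB : <<s gen >> B.
  have : measurable_fun setT (Z : T1 -> R) by apply/measurable_EFinP; rewrite ZE.
  move=> /(_ measurableT _ (measurable_itv `]b, +oo[)); rewrite setTI.
  by congr (<<s gen >> _); apply/seteqP; split => w /=; rewrite in_itv/= andbT.
have mB := msub _ sB.
have mZ : measurable_fun setT (Z : Omega -> R) by apply/measurable_EFinP; rewrite ZE; exact: (measurable_int P fiP).
have iB : (\int[P]_(w in B) `|(Z w - b)%:E| = 0)%E.
  apply/le_anti/andP; split; last exact: integral_ge0.
  have -> : (\int[P]_(w in B) `|(Z w - b)%:E| = \int[P]_(w in B) ((Z w)%:E - b%:E))%E.
    by apply: eq_integral => w; rewrite inE => /ltW bZ; rewrite gee0_abs // lee_fin subr_ge0.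
  rewrite integralB //; last 2 first.
  - by apply: (integrableS measurableT) => //; rewrite -/(EFin \o Z) ZE.
  - by apply: finite_measure_integrable_cst.
  rewrite integral_cst // sube_le0.
  have := Yb B sB; rewrite -fA //; congr (_ <= _)%E.
  by apply: eq_integral => w _; rewrite -ZE.
have mZb : measurable_fun B (fun w => (Z w - b)%:E).
  by apply/measurable_funTS/measurable_EFinP; exact: measurable_funB.
have := (ae_eq_integral_abs P mB mZb).1 iB.
apply: filterS => w Bw; rewrite leNgt; apply/negP => bZ.
by have /eqP := Bw bZ; rewrite eqe subr_eq0 => /eqP Zb; rewrite Zb ltxx in bZ.
Qed.

End ConditionalExpectation.

(** * Stochastic gradient steps *)

Section LipschitzContinuity.
Context {R : realType}.

Lemma mxnorm_le_enorm n (v : 'rV[R]_n) : `|v| <= enorm v.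
Proof.
rewrite /Num.norm /= mx_normrE; apply: bigmax_le => [|i _]; first exact: enorm_ge0.
exact: coord_le_enorm.
Qed.

(** The estimate is Euclidean while the topology comes from the max norm: continuity of the
    Euclidean distance handles the source, [mxnorm_le_enorm] the target. *)
Lemma lipschitz_within_continuous n p (A : set 'rV[R]_n) (g : 'rV[R]_n -> 'rV[R]_p)
    (K : R) :
  (forall u v, A u -> A v -> enorm (g u - g v) <= K * enorm (u - v)) ->
  {within A, continuous g}.
Proof.
move=> gK; apply/subspace_continuousP => x Ax.
apply/cvgrPdist_lt => e e0; rewrite /within /=.
have K1 : 0 < `|K| + 1 by rewrite ltr_wpDl.
have d0 : 0 < e / (`|K| + 1) by rewrite divr_gt0.
have /cvgrPdist_lt/(_ _ d0) := @enormB_continuous R n x x.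
rewrite subrr enorm0; apply: filterS => y; rewrite sub0r normrN ger0_norm ?enorm_ge0 //.
rewrite ltr_pdivlMr // => yx Ay.
rewrite (le_lt_trans (mxnorm_le_enorm _)) // (le_lt_trans (gK _ _ Ax Ay)) //.
rewrite enormB (le_lt_trans _ yx) // mulrC ler_wpM2l ?enorm_ge0 //.
by rewrite (le_trans (ler_norm _)) // lerDl.
Qed.

End LipschitzContinuity.

Section StochasticGradient.
Context {R : realType} {d : measure_display} {Omega : measurableType d}.
Context {N m : nat} {n : 'I_N -> nat}.
Local Notation profile := ('rV[R]_(\sum_i n i)).
Variables (P : probability Omega R) (xi : Omega -> 'rV[R]_m).
Variables (X : forall i, set 'rV[R]_(n i)).
Variables (psi : 'I_N -> profile -> 'rV[R]_m -> R) (M : 'I_N -> R).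
Hypothesis hA : assumptionA P xi X psi M.
Hypothesis hD : assumptionD P xi X psi.
Variables (mu : R) (xref : profile).
Hypothesis mu_gt0 : 0 < mu.
Hypothesis Xref : profiles X xref.

Local Notation f := (cost P xi psi).
Local Notation br := (prox_br P xi X psi mu).
Local Notation Q i := (2 * M i ^+ 2 / mu ^+ 2 + 2 * diameter (@X i) ^+ 2).

Lemma X_neq0 i : @X i !=set0. Proof. by exists (block i xref). Qed.

Lemma random_element_meas_rv k (Y : Omega -> 'rV[R]_k) : random_element Y -> meas_rv Y.
Proof.
move=> mY; apply: borel_meas_rv => B oB; apply: mY; exists B => //.
exact: sub_sigma_algebra.
Qed.

Lemma projX_lipschitz i (u v : 'rV[R]_(n i)) :
  enorm (Defs.proj (@X i) u - Defs.proj (@X i) v) <= enorm (u - v).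
Proof.
apply: proj_lipschitz; [exact: X_neq0|exact: A_compact hA i|exact: A_convex hA i].
Qed.

Lemma proj_meas d' (T : measurableType d') i (g : T -> 'rV[R]_(n i)) :
  meas_rv g -> meas_rv (fun w => Defs.proj (@X i) (g w)).
Proof.
move=> mg; apply: (@meas_rv_within _ _ _ _ _ g (Defs.proj (@X i)) setT) => //.
apply: (lipschitz_within_continuous (K := 1)) => u v _ _; rewrite mul1r.
exact: projX_lipschitz.
Qed.

Lemma grad_psi_meas d' (T : measurableType d') i (x : T -> profile)
    (s : T -> 'rV[R]_m) :
  meas_rv x -> meas_rv s -> (forall w, profiles X (x w)) ->
  meas_rv (fun w => grad i (psi i ^~ (s w)) (x w)).
Proof.
move=> mx ms Xx; apply: borel_meas_rv => B oB.
have bB : borel B by exact: sub_sigma_algebra.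
have := meas_rv_pair mx ms (A_measurable hA bB).
congr measurable; apply/seteqP; split => w /=; first by case.
by split.
Qed.

Lemma block_meas d' (T : measurableType d') i (x : T -> profile) :
  meas_rv x -> meas_rv (fun w => block i (x w)).
Proof. by move=> mx k; under eq_fun do rewrite blockE; exact: mx. Qed.

Lemma blocks_meas d' (T : measurableType d') (x : T -> profile) :
  (forall i, meas_rv (fun w => block i (x w))) -> meas_rv x.
Proof.
move=> mx s; rewrite -(tagnat.sig2K s); under eq_fun do rewrite -blockE.
exact: mx.
Qed.

Lemma upd_meas d' (T : measurableType d') i (x : T -> profile)
    (u : T -> 'rV[R]_(n i)) :
  meas_rv x -> meas_rv u -> meas_rv (fun w => upd (x w) (u w)).
Proof.
move=> mx mu'; apply: blocks_meas => j.
have [<-|ij] := eqVneq i j; first by under eq_fun do rewrite block_upd.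
by under eq_fun do rewrite block_upd_neq //; exact: block_meas.
Qed.

(** [prox_br] selects a minimizer by choice; the contraction estimate makes it Lipschitz on the
    feasible profiles, with the norm of Gamma as constant, hence measurable along feasible data. *)
Lemma br_meas d' (T : measurableType d') i (y : T -> profile) :
  meas_rv y -> (forall w, profiles X (y w)) -> meas_rv (fun w => br i (y w)).
Proof.
move=> my Xy; apply: (@meas_rv_within _ _ _ _ _ y (br i) (profiles X)) => //.
apply: (lipschitz_within_continuous (K := infty_norm (Gamma P xi X psi mu))) => u v Xu Xv.
apply: le_trans (prox_br_contraction hA hD mu_gt0 Xref i Xu Xv) _.
apply: (@le_trans _ _ (\sum_j Gamma P xi X psi mu i j * enorm (u - v))).
  apply: ler_sum => j _; rewrite ler_wpM2l ?(Gamma_ge0 hD mu_gt0 Xref) //.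
  by rewrite -blockB enorm_block_le.
by rewrite -mulr_suml ler_wpM2r ?enorm_ge0 // (Gamma_row_sum P xi X psi mu i).
Qed.

(** The best response is a fixed point of the projection, which is nonexpansive, so the square can
    be expanded around it. The cross term contracts by 2 / t through strong monotonicity, and the
    squared direction contributes 2 (M^2 + mu^2 diameter^2) / (mu t)^2, which is Q / t^2. *)
Lemma sgd_step i (y : profile) (v : 'rV[R]_(n i)) (t : R) :
  profiles X y -> @X i v -> 0 < t ->
  (\int[P]_w (enorm (Defs.proj (@X i) (v - (mu * t)^-1 *:
       (grad i (psi i ^~ (xi w)) (upd y v) + mu *: (v - block i y))) - br i y) ^+ 2)%:E
   <= ((1 - 2 / t) * enorm (v - br i y) ^+ 2 + Q i / t ^+ 2)%:E)%E.
Proof.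
move=> Xy Xv t0.
have Xx := profiles_upd Xy Xv.
have [Xb _] := prox_br_min hA mu i Xy.
have monot := prox_grad_monotone hA hD mu_gt0 Xref Xy Xv.
have sD : enorm (v - block i y) <= diameter (@X i).
  by apply: diameter_ge => //; exact: A_compact hA i.
have hs2 : enorm (v - block i y) ^+ 2 <= diameter (@X i) ^+ 2.
  by rewrite ler_sqr ?nnegrE ?enorm_ge0 // (le_trans (enorm_ge0 _) sD).
pose g w := grad i (psi i ^~ (xi w)) (upd y v).
have mg : meas_rv g.
  apply: (@grad_psi_meas _ _ i (fun=> upd y v) xi) => //.
  exact: random_element_meas_rv (A_noise hA).
have gE k : (\int[P]_w (g w 0 k)%:E = (grad i (f i) (upd y v) 0 k)%:E)%E.
  by rewrite (A_grad hA k Xx) expectation.unlock.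
have g2E : (\int[P]_w (enorm (g w) ^+ 2)%:E <= (M i ^+ 2)%:E)%E.
  by have := A_bound hA i Xx; rewrite expectation.unlock.
have mg2 : measurable_fun setT (fun w => enorm (g w) ^+ 2).
  by apply: measurable_funX; exact: meas_enorm.
have ig2 : P.-integrable setT (fun w => (enorm (g w) ^+ 2)%:E).
  apply/integrableP; split; first exact/measurable_EFinP.
  under eq_integral do rewrite gee0_abs ?lee_fin ?sqr_ge0 //.
  exact: le_lt_trans g2E (ltry _).
have ig k : P.-integrable setT (fun w => (g w 0 k)%:E).
  apply: (@le_integrable _ _ _ P _ _ _ (fun w => 1 + (enorm (g w) ^+ 2)%:E)%E) => //.
  - by apply/measurable_EFinP; exact: mg.
  - move=> w _ /=; rewrite lee_fin (ger0_norm (addr_ge0 ler01 (sqr_ge0 _))).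
    have := coord_le_enorm (g w) 0 k; have := sqr_ge0 (enorm (g w) - 1); nra.
  - by apply: integrableD => //; exact: finite_measure_integrable_cst.
move: monot; rewrite dotDl dotZl.
have -> : dot (grad i (f i) (upd y v)) (v - br i y) =
    \sum_k grad i (f i) (upd y v) 0 k * (v - br i y) 0 k by rewrite /dot big_ord1.
move eE : (v - br i y) => e; move sE : (v - block i y) => s in hs2 *.
move=> monot.
pose ga := (mu * t)^-1.
have ga0 : 0 <= ga by rewrite invr_ge0 mulr_ge0 // ltW.
pose K0 := enorm e ^+ 2 - 2 * ga * (mu * dot s e) + 2 * ga ^+ 2 * (mu ^+ 2 * enorm s ^+ 2).
(* A pointwise majorant that involves the noise only through the coordinates of g and |g|^2, the
   quantities whose integrals are known or bounded. *)
pose U w : R := K0 + (\sum_k (- 2 * ga * e 0 k) * g w 0 k + 2 * ga ^+ 2 * enorm (g w) ^+ 2).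
have ptw w : enorm (Defs.proj (@X i) (v - ga *: (g w + mu *: s)) - br i y) ^+ 2 <= U w.
  have step1 : enorm (Defs.proj (@X i) (v - ga *: (g w + mu *: s)) - br i y) ^+ 2
      <= enorm (e - ga *: (g w + mu *: s)) ^+ 2.
    rewrite ler_sqr ?nnegrE ?enorm_ge0 //.
    have brE : Defs.proj (@X i) (br i y) = br i y.
      by apply: proj_id => //; exact: A_compact hA i.
    rewrite -{1}brE -eE.
    have -> : v - br i y - ga *: (g w + mu *: s) = v - ga *: (g w + mu *: s) - br i y.
      by rewrite addrAC.
    exact: projX_lipschitz.
  apply: le_trans step1 _.
  rewrite enorm_sqrB enormZ exprMn real_normK ?num_real //.
  rewrite dotC dotZl dotDl dotZl.
  have h2 : enorm (g w + mu *: s) ^+ 2 <= 2 * enorm (g w) ^+ 2 + 2 * (mu ^+ 2 * enorm s ^+ 2).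
    have := sqr_ge0 (enorm (g w - mu *: s)).
    rewrite (enorm_sqrB (g w)) (enorm_sqrD (g w)) enormZ exprMn real_normK ?num_real //.
    lra.
  have := ler_wpM2l (sqr_ge0 ga) h2.
  have -> : U w = K0 - 2 * ga * dot (g w) e + 2 * ga ^+ 2 * enorm (g w) ^+ 2.
    rewrite /U addrA; congr (_ + _ + _).
    rewrite /dot big_ord1 mulr_sumr -sumrN; apply: eq_bigr => k _; ring.
  rewrite /K0; lra.
have mU : measurable_fun setT U.
  apply: measurable_funD => //; apply: measurable_funD.
    by apply: measurable_sum => k; apply: measurable_funM => //; exact: mg.
  exact: measurable_funM.
apply: (@le_trans _ _ (\int[P]_w (U w)%:E)%E).
  apply: ge0_le_integral => //.
  - by move=> w _; rewrite lee_fin sqr_ge0.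
  - apply/measurable_EFinP; apply: measurable_funX; apply: meas_enorm.
    apply: meas_rvB; last exact: (meas_rv_cst (br i y)).
    apply: proj_meas; apply: meas_rvB; first exact: (meas_rv_cst v).
    by apply: meas_rvZ; apply: meas_rvD => //; exact: (meas_rv_cst (mu *: s)).
  - exact/measurable_EFinP.
  - by move=> w _; rewrite lee_fin ptw.
have -> : (\int[P]_w (U w)%:E = K0%:E +
   ((\sum_k (- 2 * ga * e 0 k) * grad i (f i) (upd y v) 0 k)%:E
     + (2 * ga ^+ 2)%:E * \int[P]_w (enorm (g w) ^+ 2)%:E))%E.
  have iS : P.-integrable setT (fun w => \sum_k (- 2 * ga * e 0 k)%:E * (g w 0 k)%:E)%E.
    by apply: integrable_sum => // k _; exact: integrableZl.
  have iG : P.-integrable setT (fun w => (2 * ga ^+ 2)%:E * (enorm (g w) ^+ 2)%:E)%E.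
    exact: integrableZl.
  have -> : (\int[P]_w (U w)%:E = \int[P]_w (K0%:E +
      ((\sum_k (- 2 * ga * e 0 k)%:E * (g w 0 k)%:E)
        + (2 * ga ^+ 2)%:E * (enorm (g w) ^+ 2)%:E)))%E.
    apply: eq_integral => w _; rewrite /U !EFinD -sumEFin.
    by congr (_ + (_ + _))%E.
  rewrite integralD //; [|exact: finite_measure_integrable_cst|exact: integrableD].
  have -> : (\int[P]_w K0%:E = K0%:E)%E.
    by rewrite -[RHS]mule1 -(@probability_setT _ _ _ P); exact: integral_cst.
  rewrite integralD // integralZl // integral_sum //; last first.
    by move=> k; exact: integrableZl.
  rewrite -sumEFin; congr (_ + (_ + _))%E.
  by apply: eq_bigr => k _; rewrite integralZl // gE.
apply: (@le_trans _ _ (K0%:E + ((\sum_k (- 2 * ga * e 0 k) * grad i (f i) (upd y v) 0 k)%:E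
     + (2 * ga ^+ 2)%:E * (M i ^+ 2)%:E))%E).
  by do 2 apply: leeD2l; apply: lee_wpmul2l => //; rewrite lee_fin mulr_ge0 ?sqr_ge0.
have -> : \sum_k (- 2 * ga * e 0 k) * grad i (f i) (upd y v) 0 k =
    - (2 * ga) * \sum_k grad i (f i) (upd y v) 0 k * e 0 k.
  by rewrite mulr_sumr; apply: eq_bigr => k _; ring.
rewrite -EFinM -!EFinD lee_fin /K0.
move: monot; set S := \sum_k _; set sd := dot s e => monot.
have gamu : ga * mu = t^-1 by rewrite /ga invfM mulrC mulVKf // gt_eqF.
have -> : (1 - 2 / t) * enorm e ^+ 2 + Q i / t ^+ 2 =
    enorm e ^+ 2 - 2 * ga * (mu * enorm e ^+ 2) +
    2 * ga ^+ 2 * (M i ^+ 2 + mu ^+ 2 * diameter (@X i) ^+ 2).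
  by rewrite /ga; field; rewrite !gt_eqF.
have h1 : 2 * ga * (mu * enorm e ^+ 2) <= 2 * ga * (S + mu * sd).
  by apply: ler_wpM2l; rewrite ?mulr_ge0.
have h2 : 2 * ga ^+ 2 * (mu ^+ 2 * enorm s ^+ 2) <= 2 * ga ^+ 2 * (mu ^+ 2 * diameter (@X i) ^+ 2).
  by apply: ler_wpM2l; rewrite ?mulr_ge0 ?sqr_ge0 // ler_wpM2l ?sqr_ge0.
lra.
Qed.

End StochasticGradient.

(** * Deterministic rates *)

Section UpdateCounts.
Context {N : nat}.
Variables (I : nat -> {set 'I_N}) (b : 'I_N -> nat) (B1 : nat).
Hypothesis updates : forall i k, exists2 l, (k <= l < k + b i)%N & i \in I l.
Hypothesis bB1 : forall i, (b i <= B1)%N.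
Hypothesis B1_gt0 : (0 < B1)%N.

Lemma nb_updatesE i k : nb_updates I i k = (\sum_(l < k) (i \in I l) + (i \in I k))%N.
Proof. by rewrite /nb_updates big_ord_recr. Qed.

Lemma block_updates i q : (q <= \sum_(l < q * B1) (i \in I l))%N.
Proof.
elim: q => // q IHq; rewrite -(big_mkord xpredT (fun l => (i \in I l) : nat)).
rewrite (big_cat_nat (n := (q * B1)%N)) //=; last by rewrite leq_mul2r leqnSn orbT.
rewrite big_mkord -[leqLHS]addn1 leq_add //.
have [l /andP[ql lq] il] := updates i (q * B1).
have lq' : (l < q.+1 * B1)%N.
  by rewrite mulSn addnC (leq_trans lq) // leq_add2l.
rewrite (big_cat_nat (n := l)) ?(ltnW lq') //= [X in (_ + X)%N]big_ltn //.
by rewrite il addnCA leq_addr.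
Qed.

(** Each completed window contributes an update and the one at k comes on top; this extra unit gives
    the perturbation the exponent (k / B1) + 1. *)
Lemma nb_updates_ge i k : i \in I k -> (k %/ B1 < nb_updates I i k)%N.
Proof.
move=> ik; rewrite nb_updatesE ik addn1 ltnS.
apply: leq_trans (block_updates i (k %/ B1)) _.
rewrite -!(big_mkord xpredT (fun l => (i \in I l) : nat)).
rewrite [leqRHS](big_cat_nat (n := (k %/ B1 * B1)%N)) ?leq_divM //=.
exact: leq_addr.
Qed.

(** A player that has not moved yet is still inside its first window, where (k + 1) / B1 has integer
    part 0 and no factor rho is owed. *)
Lemma last_update i k : ((k.+1 < B1)%N /\ forall l, (l <= k)%N -> i \notin I l) \/
  exists l, [/\ (l <= k)%N, (k < l + B1)%N, i \in I l &
                forall l', (l < l' <= k)%N -> i \notin I l'].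
Proof.
have [no|[l [lk il lmax]]] : (forall l, (l <= k)%N -> i \notin I l) \/
    exists l, [/\ (l <= k)%N, i \in I l & forall l', (l < l' <= k)%N -> i \notin I l'].
  elim: k => [|k IHk].
    case i0: (i \in I 0%N); last by left=> l; rewrite leqn0 => /eqP ->; rewrite i0.
    by right; exists 0%N; split=> // l'; case: l'.
  case ik: (i \in I k.+1).
    by right; exists k.+1; split=> // l' /andP[/leq_trans h /h]; rewrite ltnn.
  case: IHk => [no|[l [lk il lmax]]].
    by left=> l; rewrite leq_eqVlt ltnS => /predU1P[->|/no//]; rewrite ik.
  right; exists l; split=> //; first exact: leqW.
  move=> l' /andP[ll']; rewrite leq_eqVlt ltnS => /predU1P[->|l'k]; first by rewrite ik.
  by apply: lmax; rewrite ll'.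
- left; split=> //; have [l /andP[_ lb] il] := updates i 0.
  have kl : (k < l)%N by rewrite ltnNge; apply: contraL il => /no.
  by rewrite add0n in lb; apply: leq_ltn_trans kl _; exact: leq_trans lb (bB1 i).
right; exists l; split=> //.
have [l' /andP[ll' l'b] il'] := updates i l.+1.
have kl' : (k < l')%N.
  by rewrite ltnNge; apply: contraL il' => l'k; apply: lmax; rewrite ll'.
have := leq_trans l'b (leq_add (leqnn l.+1) (bB1 i)); rewrite addSn ltnS.
exact: leq_trans.
Qed.

Lemma sum_updates_le i k : (\sum_(l < k) (i \in I l) <= k)%N.
Proof.
rewrite -[leqRHS]card_ord -sum1_card; apply: leq_sum => l _; exact: leq_b1.
Qed.

End UpdateCounts.

(** * Thresholds for the iterations and the gradient steps *)

Section Rates.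
Context {R : realType}.
Implicit Types c q D C rho eps : R.

(* This is e x <= exp x at x = k ln (q / c). *)
Lemma mulrn_geom_le c q D (k : nat) : 0 < c -> c < q ->
  1 / ln ((q / c) `^ expR 1) <= D -> k%:R * c ^+ k <= D * q ^+ k.
Proof.
move=> c0 cq hD; have q0 := lt_trans c0 cq.
have r1 : 1 < q / c by rewrite ltr_pdivlMr // mul1r.
have r0 : 0 < q / c by rewrite divr_gt0.
set l := ln (q / c); have l0 : 0 < l by rewrite ln_gt0.
have rE : expR (k%:R * l) = q ^+ k / c ^+ k.
  by rewrite expRM_natl lnK // expr_div_n.
have e0 : 0 < expR (1 : R) by exact: expR_gt0.
have : expR 1 * (k%:R * l) <= expR (k%:R * l).
  have := expR_ge1Dx (k%:R * l - 1); rewrite addrC subrK expRD expRN.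
  by rewrite ler_pdivlMr // mulrC.
rewrite rE ler_pdivlMr ?exprn_gt0 // => h.
move: hD; rewrite ln_powR -/l div1r => hD.
have el : 0 < expR 1 * l by rewrite mulr_gt0.
apply: le_trans (ler_wpM2r (exprn_ge0 k (ltW q0)) hD).
rewrite ler_pdivlMl // (le_trans _ h) // le_eqVlt; apply/orP; left; apply/eqP; ring.
Qed.

(** Taking the floor of K / B1 loses at most (B1 - 1) / B1, whence rho^floor(K / B1) <= c^K / p; the
    factor p of epshat cancels this loss, and (C + K) c^K <= (C + D) q^K <= (C + D) epshat
    remains. *)
Lemma error_threshold rho q C D eps (B1 K : nat) :
  0 < rho -> rho <= 1 -> (0 < B1)%N -> 0 <= C -> 0 < eps ->
  rho `^ (1 / B1%:R) < q < 1 ->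
  1 / ln ((q / rho `^ (1 / B1%:R)) `^ expR 1) <= D ->
  ln (1 / (eps / (C + D) * rho `^ ((B1%:R - 1) / B1%:R))) / ln (1 / q) <= K%:R ->
  rho ^+ (K %/ B1) * (C + K%:R) <= eps.
Proof.
move=> rho0 rho1 B10 C0 eps0; set c := rho `^ (1 / B1%:R) => /andP[cq q1] hD.
have c0 : 0 < c by rewrite powR_gt0.
have q0 := lt_trans c0 cq.
have D0 : 0 < D.
  apply: lt_le_trans hD; rewrite div1r invr_gt0 ln_powR mulr_gt0 ?expR_gt0 //.
  by rewrite ln_gt0 // ltr_pdivlMr // mul1r.
have CD0 : 0 < C + D by rewrite ltr_wpDl.
have B1r : 0 < B1%:R :> R by rewrite ltr0n.
set p := rho `^ _; have p0 : 0 < p by rewrite powR_gt0.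
set eh := eps / (C + D) * p; have eh0 : 0 < eh by rewrite mulr_gt0 ?divr_gt0.
rewrite !div1r !lnV ?posrE // invrN mulrN mulNr opprK => hK.
have lq : ln q < 0 by rewrite ln_lt0 // q0.
have qK : q ^+ K <= eh.
  rewrite -[eh]lnK ?posrE // -[q]lnK ?posrE // -expRM_natl ler_expR.
  by rewrite -ler_ndivrMr.
have flo : rho ^+ (K %/ B1) * p <= c ^+ K.
  rewrite -[rho in leLHS]lnK ?posrE // -expRM_natl -[p]lnK ?posrE // -expRD.
  rewrite -[c]lnK ?posrE // -expRM_natl ler_expR /p /c !ln_powR.
  have lr : ln rho <= 0 by rewrite ln_le0.
  rewrite mulrA -mulrDl ler_wnM2r // div1r ler_pdivrMr // mulrDl divfK ?gt_eqF //.
  rewrite -natrM -lerBlDr.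
  have : (K < (K %/ B1).+1 * B1)%N by rewrite ltn_ceil.
  rewrite mulSn addnC -(ler_nat R) -natr1 natrD; lra.
have step1 : rho ^+ (K %/ B1) <= c ^+ K / p by rewrite ler_pdivlMr.
apply: le_trans (ler_wpM2r _ step1) _; first by rewrite addr_ge0.
have kc := mulrn_geom_le K c0 cq hD.
have cqK : C * c ^+ K <= C * q ^+ K.
  by rewrite ler_wpM2l // lerXn2r ?nnegrE ?(ltW c0) ?(ltW q0) ?(ltW cq).
rewrite mulrAC ler_pdivrMr //.
apply: (@le_trans _ _ ((C + D) * q ^+ K)); first by lra.
apply: (@le_trans _ _ ((C + D) * eh)); first by rewrite ler_wpM2l // ltW.
by rewrite /eh mulrA (mulrC (C + D)) divfK // gt_eqF.
Qed.

(** With r = 1 / eta^2 the exponent K + 1 is at most 2 more than ln (1 / eh) / ln (1 / q): the 2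
    becomes r^2 = 1 / eta^4, the rest the real power of 1 / eh. *)
Lemma steps_threshold eta q eh (K : nat) : 0 < eta < 1 -> 0 < q < 1 -> 0 < eh ->
  K%:R <= ln (1 / eh) / ln (1 / q) + 1 ->
  (1 / eta ^+ 2) ^+ K.+1 <=
    (1 / eta ^+ 4) * (1 / eh) `^ (ln (1 / eta ^+ 2) / ln (1 / q)).
Proof.
move=> /andP[eta0 eta1] /andP[q0 q1] eh0 hK.
set r := 1 / eta ^+ 2.
have r0 : 0 < r by rewrite divr_gt0 ?exprn_gt0.
have r1 : 1 < r by rewrite /r div1r invf_gt1 ?exprn_gt0 // exprn_ilt1 // ltW.
have l0 : 0 < ln r by rewrite ln_gt0.
have -> : 1 / eta ^+ 4 = r ^+ 2.
  by rewrite /r !div1r exprVn -exprM.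
rewrite -[r in leLHS]lnK ?posrE // -[r in r ^+ 2]lnK ?posrE // -!expRM_natl.
have E : 0 < 1 / eh by rewrite divr_gt0.
rewrite /powR gt_eqF // -expRD ler_expR -natr1.
rewrite mulrAC -mulrA -/r [ln r * _]mulrC -mulrDl ler_wpM2r ?(ltW l0) //.
lra.
Qed.

Variables (N : nat) (I : nat -> {set 'I_N}) (i : 'I_N) (jj : 'I_N -> nat -> nat).
Variables (Q eta : R).
Hypotheses (Q_ge0 : 0 <= Q) (eta01 : 0 < eta < 1).
Hypothesis jj_le : forall k, i \in I k ->
  (jj i k)%:R <= Q / (eta ^+ nb_updates I i k) ^+ 2.

(** The right-hand side is an integral of r^s majorizing the sum of Q r^p over the updates. Its
    exponent counts updates rather than iterations, so an idle iteration changes neither side. *)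
Lemma nb_steps_geom K : (nb_steps I jj i K)%:R <=
  Q / ln (1 / eta ^+ 2) * (1 / eta ^+ 2) ^+ (\sum_(l < K) (i \in I l)).+1.
Proof.
have /andP[eta0 eta1] := eta01.
set r := 1 / eta ^+ 2.
have r0 : 0 < r by rewrite divr_gt0 ?exprn_gt0.
have r1 : 1 < r by rewrite /r div1r invf_gt1 ?exprn_gt0 // exprn_ilt1 // ltW.
have l0 : 0 < ln r by rewrite ln_gt0.
elim: K => [|K IHK].
  by rewrite /nb_steps big_ord0 mulr_ge0 ?divr_ge0 ?exprn_ge0 // ltW.
rewrite /nb_steps big_mkcond big_ord_recr /= -big_mkcond /= -/(nb_steps _ _ _ _).
rewrite [in leRHS]big_ord_recr /= natrD.
set p := (\sum_(l < K) (i \in I l))%N in IHK *.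
case: ifP => iK; last by rewrite addr0 addn0.
have jK : (jj i K)%:R <= Q * r ^+ p.+1.
  apply: le_trans (jj_le iK) _.
  by rewrite nb_updatesE iK addn1 -/p /r div1r exprVn -!exprM mulnC.
rewrite addn1 [r ^+ p.+2]exprS.
apply: (@le_trans _ _ (Q / ln r * r ^+ p.+1 + Q * r ^+ p.+1)); first exact: lerD.
have -> : Q / ln r * r ^+ p.+1 + Q * r ^+ p.+1 = Q / ln r * (r ^+ p.+1 * (1 + ln r)).
  by field; rewrite gt_eqF.
rewrite ler_wpM2l ?divr_ge0 ?(ltW l0) // [leRHS]mulrC ler_wpM2l ?exprn_ge0 ?(ltW r0) //.
by rewrite -[leRHS]lnK ?posrE // expR_ge1Dx.
Qed.

End Rates.

(** * The asynchronous scheme *)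

Section RunConstruction.
Context {R : realType} {d : measure_display} {Omega : measurableType d}.
Context {N m : nat} {n : 'I_N -> nat}.
Local Notation profile := ('rV[R]_(\sum_i n i)).
Variables (X : forall i, set 'rV[R]_(n i)).
Variables (psi : 'I_N -> profile -> 'rV[R]_m -> R).
Variables (I : nat -> {set 'I_N}) (tau : 'I_N -> 'I_N -> nat -> Omega -> nat).
Variable (x0 : Omega -> profile).
Variable (smp : 'I_N -> nat -> nat -> Omega -> 'rV[R]_m).
Variables (mu : R) (jj : 'I_N -> nat -> nat).

Definition scheme_step (h : nat -> Omega -> profile) (k : nat) (w : Omega) : profile :=
  \mxrow_i if i \in I k then
      sa_iter X psi mu (outdated tau h i k w) (block i (h k w))
              (fun t => smp i k t w) (jj i k)
    else block i (h k w).

(* The state of the recursion is the whole history, because the delayed data of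
   iteration k involve every earlier iterate. *)
Fixpoint history (k : nat) : nat -> Omega -> profile :=
  if k is k'.+1 then
    fun l => if (l <= k')%N then history k' l else scheme_step (history k') k'
  else fun=> x0.

Lemma history_diag k l : (l <= k)%N -> history k l = history l l.
Proof.
elim: k => [|k IHk]; first by rewrite leqn0 => /eqP ->.
rewrite leq_eqVlt ltnS => /predU1P[->//|lk] /=.
by rewrite lk IHk.
Qed.

Lemma sa_run_exists : exists x, sa_run X psi I tau x0 smp mu jj x.
Proof.
exists (fun k => history k k); split=> // k w i.
rewrite /= ltnn /block mxrowK.
suff -> : outdated tau (history k) i k w = outdated tau (fun k => history k k) i k w by [].
by rewrite /outdated; apply: eq_mxrow => j; rewrite history_diag // leq_subr.
Qed.

End RunConstruction.

Section Scheme.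
Context {R : realType} {d : measure_display} {Omega : measurableType d}.
Context {N m : nat} {n : 'I_N -> nat}.
Local Notation profile := ('rV[R]_(\sum_i n i)).
Variables (P : probability Omega R) (xi : Omega -> 'rV[R]_m).
Variables (X : forall i, set 'rV[R]_(n i)).
Variables (psi : 'I_N -> profile -> 'rV[R]_m -> R) (M : 'I_N -> R).
Hypothesis hA : assumptionA P xi X psi M.
Hypothesis hD : assumptionD P xi X psi.
Variables (mu : R) (xref : profile).
Hypothesis mu_gt0 : 0 < mu.
Hypothesis Xref : profiles X xref.
Variables (I : nat -> {set 'I_N}) (tau : 'I_N -> 'I_N -> nat -> Omega -> nat).
Hypothesis htau : delays_ok I tau.
Variable (x0 : Omega -> profile).
Hypotheses (hx0 : random_element x0) (hx0X : forall w, profiles X (x0 w)).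
Variable (smp : 'I_N -> nat -> nat -> Omega -> 'rV[R]_m).
Hypothesis hsmp : sampling P xi I tau x0 smp.
Variables (jj : 'I_N -> nat -> nat) (x : nat -> Omega -> profile).
Hypothesis hx : sa_run X psi I tau x0 smp mu jj x.

Local Notation br := (prox_br P xi X psi mu).
Local Notation Q i := (2 * M i ^+ 2 / mu ^+ 2 + 2 * diameter (@X i) ^+ 2).
Local Notation y i k w := (outdated tau x i k w).
Local Notation z i k t w := (sa_iter X psi mu (y i k w) (block i (x k w))
  (fun s => smp i k s w) t).

(* All the delays, future ones included, belong to the past: the delay of an
   update may depend on earlier delays, hence on the iterates that it selects,
   so the error bounds are needed conditionally on the whole delay process. *)
Definition past_gen i k t : set (set Omega) :=
  [set A | sample_past x0 smp i k t A \/ all_delays I tau A].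

(** Measurability for a sub-sigma-algebra is plain measurability once Omega carries that
    sigma-algebra as its structure. *)
Local Notation gmeas gen f := (@meas_rv R _ (g_sigma_algebraType gen) _ f).

Lemma block_outdated i j k w : block j (y i k w) = block j (x (k - tau i j k w)%N w).
Proof. by rewrite /block mxrowK. Qed.

Lemma sa_iter_X i (yy : profile) (c : 'rV[R]_(n i)) s t : @X i c ->
  @X i (sa_iter X psi mu yy c s t).
Proof.
move=> Xc; case: t => [//|t] /=; case: eqP => // _.
by apply: (proj_spec _ _ _).1; [exact: X_neq0 Xref i|exact: A_compact hA i].
Qed.

Lemma x_profiles k w : profiles X (x k w).
Proof.
have [x0E xS] := hx; elim: k => [|k IHk]; first by rewrite x0E.
by move=> i; rewrite xS; case: ifP => _; [exact: sa_iter_X|exact: IHk].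
Qed.

Lemma outdated_profiles i k w : profiles X (y i k w).
Proof. by move=> j; rewrite block_outdated; exact: x_profiles. Qed.

Lemma sample_past_measurable i k t : sample_past x0 smp i k t `<=` measurable.
Proof.
have [msmp _ _ _] := hsmp.
apply: sigma_algebra_sub => A [xA|[j [l [s [_ _ sA]]]]|[s _ sA]].
- exact: hx0.
- exact: msmp sA.
- exact: msmp sA.
Qed.

Lemma all_delays_measurable : all_delays I tau `<=` measurable.
Proof.
apply: sigma_algebra_sub => A [i [j [k [ik tA]]]].
by have [mt _ _] := htau ik; exact: mt tA.
Qed.

Lemma past_gen_measurable i k t : past_gen i k t `<=` measurable.
Proof. by move=> A [/sample_past_measurable|/all_delays_measurable]. Qed.

(** * Growing pasts and measurability of the iterates *)

Lemma past_gen_sub i k t j l s :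
  (forall A, sample_past x0 smp i k t A -> sample_past x0 smp j l s A) ->
  <<s past_gen i k t >> `<=` <<s past_gen j l s >>.
Proof.
move=> h; apply: smallest_sub; first exact: smallest_sigma_algebra.
by move=> A [/h pA|dA]; apply: sub_sigma_algebra; [left|right].
Qed.

Lemma past_mono i k t t' : (t <= t')%N ->
  <<s past_gen i k t >> `<=` <<s past_gen i k t' >>.
Proof.
move=> tt'; apply: past_gen_sub; apply: sub_sigma_algebra2.
move=> B [xB|sB|[s /andP[s0 st] sB]]; first by apply: Or31.
  by apply: Or32.
by apply: Or33; exists s => //; rewrite s0 (leq_trans st).
Qed.

(** At t = 1 no sample of iteration k has been drawn yet, so the past is common to all players. *)
Lemma past_start i j k t : <<s past_gen i k 1 >> `<=` <<s past_gen j k t >>.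
Proof.
apply: past_gen_sub; apply: sub_sigma_algebra2.
move=> B [xB|sB|[s /andP[s0 st] sB]]; first by apply: Or31.
  by apply: Or32.
by move: st; rewrite ltnS leqNgt s0.
Qed.

Lemma past_next i j k t : <<s past_gen i k t >> `<=` <<s past_gen j k.+1 1 >>.
Proof.
apply: past_gen_sub; apply: sub_sigma_algebra2.
move=> B [xB|[i' [l [s [lk s0 sB]]]]|[s /andP[s0 st] sB]]; first by apply: Or31.
  by apply: Or32; exists i', l, s; split=> //; exact: ltnW.
by apply: Or32; exists i, k, s.
Qed.

Lemma past_le i j k l t : (l <= k)%N ->
  <<s past_gen i l 1 >> `<=` <<s past_gen j k t >>.
Proof.
elim: k j t => [|k IHk] j t; first by rewrite leqn0 => /eqP ->; exact: past_start.
rewrite leq_eqVlt ltnS => /predU1P[->|/(IHk j 1%N) h]; first exact: past_start.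
apply: subset_trans h _; apply: subset_trans (@past_next j j k 1) _.
exact: past_start.
Qed.

Lemma gmeas_sub gen gen' p (f : Omega -> 'rV[R]_p) :
  <<s gen >> `<=` <<s gen' >> -> gmeas gen f -> gmeas gen' f.
Proof.
by move=> h mf k _ B mB; rewrite setTI; apply: h; have := mf k measurableT B mB; rewrite setTI.
Qed.

Lemma gmeas_meas gen p (f : Omega -> 'rV[R]_p) :
  gen `<=` measurable -> gmeas gen f -> @meas_rv R _ Omega p f.
Proof.
move=> mgen mf k _ B mB; have := mf k measurableT B mB; rewrite !setTI.
exact: sigma_algebra_sub.
Qed.

Lemma past_sigma_measurable i k t : <<s past_gen i k t >> `<=` measurable.
Proof. by apply: sigma_algebra_sub; exact: past_gen_measurable. Qed.

Lemma smp_meas i k s t : (0 < s < t)%N -> gmeas (past_gen i k t) (smp i k s).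
Proof.
move=> st; apply: borel_meas_rv => B oB; apply: sub_sigma_algebra; left.
apply: sub_sigma_algebra; apply: Or33; exists s => //; exists B => //.
exact: sub_sigma_algebra.
Qed.

Lemma tau_set1 i j k s : i \in I k -> all_delays I tau (tau i j k @^-1` [set s]).
Proof.
move=> ik; apply: sub_sigma_algebra; exists i, j, k; split=> //.
exists [set s] => //; apply: sub_sigma_algebra; exact: discrete_open.
Qed.

Lemma outdated_meas i k t : i \in I k ->
  (forall l, (l <= k)%N -> gmeas (past_gen i k t) (x l)) ->
  gmeas (past_gen i k t) (fun w => y i k w).
Proof.
move=> ik mx; apply: (@blocks_meas R N n) => j.
rewrite (_ : (fun w => _) = (fun w => block j (x (k - tau i j k w)%N w))); last first.
  by apply/funext => w; rewrite block_outdated.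
apply: (@meas_rv_natcase R _ (g_sigma_algebraType (past_gen i k t)) _ (tau i j k)
  (fun s w => block j (x (k - s)%N w))).
  by move=> s; apply: sub_sigma_algebra; right; exact: tau_set1.
by move=> s; apply: (@block_meas R N n); apply: mx; exact: leq_subr.
Qed.

(** The iterate z_t uses the samples 1, ..., t - 1 only; the strict bound in [sample_past] thus
    leaves the sample of step t independent of everything that it meets. *)
Lemma z_meas i k t : i \in I k ->
  (forall l, (l <= k)%N -> gmeas (past_gen i k 1) (x l)) ->
  gmeas (past_gen i k t) (fun w => z i k t w).
Proof.
move=> ik mx.
have mx' s l : (l <= k)%N -> gmeas (past_gen i k s) (x l).
  by move=> /mx; apply: gmeas_sub; exact: past_start.
elim: t => [|t IHt] /=; first by apply: (@block_meas R N n); exact: mx'.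
case: eqP => [_|/eqP t0]; first by apply: (@block_meas R N n); exact: mx'.
have {}IHt : gmeas (past_gen i k t.+1) (fun w => z i k t w).
  by apply: gmeas_sub IHt; exact: past_mono.
have my : gmeas (past_gen i k t.+1) (fun w => y i k w).
  by apply: outdated_meas => // l; exact: mx'.
apply: (proj_meas hA Xref); apply: meas_rvB => //; apply: meas_rvZ; apply: meas_rvD.
  apply: (grad_psi_meas hA).
  - exact: upd_meas.
  - by apply: smp_meas; rewrite lt0n t0 /=.
  - move=> w; apply: profiles_upd; first exact: outdated_profiles.
    by apply: sa_iter_X; exact: x_profiles.
apply: meas_rvZ; apply: meas_rvB => //.
by apply: (@block_meas R N n); exact: mx'.
Qed.

Lemma x_meas j k : gmeas (past_gen j k 1) (x k).
Proof.
have [x0E xS] := hx.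
(* Strong induction, since outdated data may involve any earlier iterate. *)
suff : forall K k j, (k <= K)%N -> gmeas (past_gen j k 1) (x k) by exact.
elim=> [|K IHK] {}k {}j; rewrite ?leqn0.
  move=> /eqP ->.
  rewrite x0E; apply: borel_meas_rv => B oB; apply: sub_sigma_algebra; left.
  apply: sub_sigma_algebra; apply: Or31; exists B => //; exact: sub_sigma_algebra.
rewrite leq_eqVlt ltnS => /predU1P[->|kK]; last exact: IHK.
have mx i l : (l <= K)%N -> gmeas (past_gen i K 1) (x l).
  by move=> lK; apply: gmeas_sub (IHK l i lK); exact: past_le.
apply: (@blocks_meas R N n) => i.
under eq_fun do rewrite xS.
case ik: (i \in I K); last first.
  by apply: (@block_meas R N n); apply: gmeas_sub (mx i K (leqnn K)); exact: past_next.
exact: (gmeas_sub (@past_next i j K (jj i K)) (@z_meas i K (jj i K) ik (mx i))).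
Qed.

Lemma x_meas_le i k l t : (l <= k)%N -> gmeas (past_gen i k t) (x l).
Proof.
by move=> lk; exact: (gmeas_sub (@past_le i i k l t lk) (@x_meas i l)).

Qed.

(** Intersections of a sample event A and a delay event B form a pi-system generating the past. For
    S in the new sample, P (S A B) = P B * P (S A) = P B * P S * P A = P S * P (A B), where the
    independence of delays and samples is used twice. *)
Lemma smp_indep i k t : i \in I k -> (0 < t)%N ->
  independent P (sigma_of (smp i k t)) <<s past_gen i k t >>.
Proof.
move=> ik t0; have [msmp _ sind dind] := hsmp.
pose H := [set C | exists A B, [/\ sample_past x0 smp i k t A, all_delays I tau B & C = A `&` B]].
have HE : <<s past_gen i k t >> `<=` <<s H >>.
  apply: smallest_sub; first exact: smallest_sigma_algebra.
  move=> A [pA|dA]; apply: sub_sigma_algebra.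
    by exists A, setT; split=> //; [exact: setT_sigma|rewrite setIT].
  by exists setT, A; split=> //; [exact: setT_sigma|rewrite setTI].
have sP A : sample_past x0 smp i k t A -> all_samples x0 smp A.
  apply: smallest_sub A; first exact: smallest_sigma_algebra.
  move=> A [xA|[j [l [s [lk s0 sA]]]]|[s /andP[s0 st] sA]]; apply: sub_sigma_algebra.
  - by left.
  - by right; exists j, l, s.
  - by right; exists i, k, s.
move=> A B sA /HE HB; move: A B sA HB; apply: independent_g_sigma.
- by move=> A; exact: msmp.
- move=> _ [A [B [/sample_past_measurable mA /all_delays_measurable mB ->]]].
  exact: measurableI.
- move=> _ _ [A [B [pA dB ->]]] [A' [B' [pA' dB' ->]]].
  exists (A `&` A'), (B `&` B'); split; [exact: setI_sigma|exact: setI_sigma|].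
  by rewrite setIACA.
- by exists setT, setT; split; [exact: setT_sigma|exact: setT_sigma|rewrite setIT].
move=> S _ sS [A [B [pA dB ->]]].
have sS' : all_samples x0 smp S by apply: sub_sigma_algebra; right; exists i, k, t.
rewrite setIA (setIC (S `&` A)) (dind _ _ dB (setI_sigma sS' (sP _ pA))).
rewrite (sind _ _ _ ik t0 _ _ sS pA) (setIC A) (dind _ _ dB (sP _ pA)).
by rewrite muleCA.
Qed.

Lemma outdated_self i k w : i \in I k -> block i (y i k w) = block i (x k w).
Proof. by move=> ik; rewrite block_outdated; have [_ _ ->] := htau ik; rewrite subn0. Qed.

Lemma diameter_sqr_le i (u v : 'rV[R]_(n i)) : @X i u -> @X i v ->
  enorm (u - v) ^+ 2 <= diameter (@X i) ^+ 2.
Proof.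
move=> Xu Xv; have uv : enorm (u - v) <= diameter (@X i).
  by apply: diameter_ge => //; exact: A_compact hA i.
by rewrite ler_sqr ?nnegrE ?enorm_ge0 // (le_trans (enorm_ge0 _) uv).
Qed.

Lemma Q_ge i : 2 * diameter (@X i) ^+ 2 <= Q i.
Proof. by rewrite lerDr divr_ge0 ?sqr_ge0 // mulr_ge0 ?sqr_ge0. Qed.

Lemma br_X i k w : @X i (br i (y i k w)).
Proof. exact: (prox_br_min hA mu i (@outdated_profiles i k w)).1. Qed.

Lemma z_X i k t w : @X i (z i k t w).
Proof. by apply: sa_iter_X; exact: x_profiles. Qed.

(** * Mean squared error of the gradient steps *)

Lemma integral_indicM (A : set Omega) (g : Omega -> R) :
  (\int[P]_(w in A) (g w)%:E = \int[P]_w (\1_A w * g w)%:E)%E.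
Proof.
rewrite integral_mkcond; apply: eq_integral => w _.
by rewrite patchE indicE; case: ifP => _; rewrite ?mul1r ?mul0r.
Qed.

Lemma meas_rv_comp d1 d2 (T1 : measurableType d1) (T2 : measurableType d2) p
    (phi : T1 -> T2) (g : T2 -> 'rV[R]_p) :
  measurable_fun setT phi -> meas_rv g -> meas_rv (g \o phi).
Proof. by move=> mphi mg k; exact: measurableT_comp (mg k) mphi. Qed.

Lemma sa_error_meas i k t s : i \in I k -> (t <= s)%N ->
  gmeas (past_gen i k s) (fun w => z i k t w - br i (y i k w)).
Proof.
move=> ik ts; apply: meas_rvB.
  apply: (gmeas_sub (@past_mono i k t s ts)); apply: z_meas => // l lk; exact: x_meas_le.
apply: (br_meas hA hD mu_gt0 Xref); last exact: outdated_profiles.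
by apply: outdated_meas => // l; exact: x_meas_le.
Qed.

(** The indicator of A and the current iterates are frozen as functions of the past; the inner
    integral over the fresh sample is then the one bounded by [sgd_step], for each fixed w. *)
Lemma sa_step i k t (A : set Omega) : i \in I k -> (0 < t)%N ->
  <<s past_gen i k t >> A ->
  (\int[P]_(w in A) (enorm (z i k t.+1 w - br i (y i k w)) ^+ 2)%:E <=
   \int[P]_(w in A) ((1 - 2 / (t%:R + 1)) * enorm (z i k t w - br i (y i k w)) ^+ 2
                      + Q i / (t%:R + 1) ^+ 2)%:E)%E.
Proof.
move=> ik t0 sA; have [msmp law _ _] := hsmp.
rewrite [leLHS]integral_indicM [leRHS]integral_indicM.
pose T1 := g_sigma_algebraType (past_gen i k t).
pose T2 := g_sigma_algebraType [set B : set 'rV[R]_m | open B].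
pose zerr (w : Omega) (s : 'rV[R]_m) := Defs.proj (@X i) (z i k t w -
  (mu * (t%:R + 1))^-1 *: (grad i (psi i ^~ s) (upd (y i k w) (z i k t w)) +
   mu *: (z i k t w - block i (x k w)))) - br i (y i k w).
pose h (ws : T1 * T2) : \bar R := (\1_A ws.1 * enorm (zerr ws.1 ws.2) ^+ 2)%:E.
have h0 ws : (0 <= h ws)%E by rewrite lee_fin mulr_ge0 ?sqr_ge0.
have mfst p (g : Omega -> 'rV[R]_p) : gmeas (past_gen i k t) g ->
    @meas_rv R _ (T1 * T2)%type p (fun ws => g ws.1).
  by move=> mg; exact: (meas_rv_comp (@measurable_fst _ _ T1 T2) mg).
have msnd : @meas_rv R _ (T1 * T2)%type m (fun ws => ws.2).
  apply: (@meas_rv_comp _ _ _ T2 _ snd id (@measurable_snd _ _ T1 T2)).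
  by apply: borel_meas_rv => B oB; apply: sub_sigma_algebra.
have mz : gmeas (past_gen i k t) (fun w => z i k t w).
  by apply: z_meas => // l; exact: x_meas_le.
have my : gmeas (past_gen i k t) (fun w => y i k w).
  by apply: outdated_meas => // l; exact: x_meas_le.
have mh : measurable_fun setT h.
  apply/measurable_EFinP; apply: measurable_funM.
    apply: measurableT_comp (@measurable_fst _ _ T1 T2).
    exact: (@measurable_indic _ T1 R setT A sA).
  apply: measurable_funX; apply: meas_enorm; apply: meas_rvB; last first.
    apply: (mfst _ (fun w => br i (y i k w))).
    by apply: (br_meas hA hD mu_gt0 Xref) => // w; exact: outdated_profiles.
  apply: (proj_meas hA Xref); apply: meas_rvB.
    exact: (mfst _ (fun w => z i k t w)).
  apply: meas_rvZ; apply: meas_rvD.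
    apply: (grad_psi_meas hA) => //.
      apply: (mfst _ (fun w => upd (y i k w) (z i k t w))); exact: upd_meas.
    by move=> ws; apply: profiles_upd; [exact: outdated_profiles|exact: z_X].
  apply: meas_rvZ; apply: (mfst _ (fun w => z i k t w - block i (x k w))).
  by apply: meas_rvB => //; apply: (@block_meas R N n); exact: x_meas_le.
have -> : (\int[P]_w (\1_A w * enorm (z i k t.+1 w - br i (y i k w)) ^+ 2)%:E =
           \int[P]_w h (w, smp i k t w))%E.
  by apply: eq_integral => w _; rewrite /h /zerr /= gtn_eqF.
have [mint ->] := freezing (past_gen_measurable (t := t)) (msmp i k t) (A_noise hA)
  (law _ _ _ ik t0) (smp_indep ik t0) mh h0.
have T0 : 0 < t%:R + 1 :> R by rewrite ltr_wpDl.
have mgen w : measurable_fun setT (fun w' => (enorm (zerr w (xi w')) ^+ 2)%:E).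
  apply/measurable_EFinP; apply: measurable_funX; apply: meas_enorm.
  have mc p (v : 'rV[R]_p) : @meas_rv R _ Omega p (fun=> v) by exact: meas_rv_cst.
  apply: meas_rvB; last exact: mc.
  apply: (proj_meas hA Xref); apply: meas_rvB; first exact: mc.
  apply: meas_rvZ; apply: meas_rvD; last exact: mc.
  apply: (grad_psi_meas hA (x := fun=> _)); first exact: mc.
    exact: random_element_meas_rv (A_noise hA).
  by move=> _; apply: profiles_upd; [exact: outdated_profiles|exact: z_X].
apply: ge0_le_integral => //.
- by move=> w _; exact: integral_ge0.
- apply/measurable_EFinP; apply: measurable_funM.
    exact: measurable_indic (past_sigma_measurable sA).
  apply: measurable_funD => //; apply: measurable_funM => //.
  apply: measurable_funX; apply: meas_enorm.
  exact: (gmeas_meas (past_gen_measurable (t := t)) (sa_error_meas ik (leqnn t))).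
move=> w _; rewrite /h /=.
under eq_integral do rewrite EFinM.
rewrite ge0_integralZl_EFin //; last by move=> w' _; rewrite lee_fin sqr_ge0.
rewrite EFinM lee_wpmul2l //.
have := sgd_step hA hD mu_gt0 Xref (@outdated_profiles i k w) (z_X i k t w) T0.
by rewrite outdated_self.
Qed.

Lemma integral_le_cst (A : set Omega) (g : Omega -> R) (K : R) :
  measurable A -> measurable_fun setT g -> (forall w, 0 <= g w <= K) ->
  (\int[P]_(w in A) (g w)%:E <= K%:E * P A)%E.
Proof.
move=> mA mg gK; rewrite -(integral_cst P mA); apply: ge0_le_integral => //.
- by move=> w _; rewrite lee_fin; case/andP: (gK w).
- exact/measurable_EFinP/measurable_funTS.
- by move=> w _; rewrite lee_fin; case/andP: (gK w).
Qed.

Lemma sa_error_measT i k t : i \in I k ->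
  measurable_fun setT (fun w => enorm (z i k t w - br i (y i k w)) ^+ 2).
Proof.
move=> ik; apply: measurable_funX; apply: meas_enorm.
exact: (gmeas_meas (past_gen_measurable (t := t)) (sa_error_meas ik (leqnn t))).
Qed.

Lemma sa_error_le i k t w :
  enorm (z i k t w - br i (y i k w)) ^+ 2 <= diameter (@X i) ^+ 2.
Proof. by apply: diameter_sqr_le; [exact: z_X|exact: br_X]. Qed.

(** For t <= 1 the error is at most diameter^2 <= Q / 2. The induction step, with T = t + 1 >= 2, is
    (1 - 2 / T) / T + 1 / T^2 <= 1 / (T + 1), with slack 1 / (T^2 (T + 1)). Here A may be any event
    known at the start of the iteration, delay events included. *)
Lemma sa_bound i k t (A : set Omega) : i \in I k -> <<s past_gen i k 1 >> A ->
  (\int[P]_(w in A) (enorm (z i k t w - br i (y i k w)) ^+ 2)%:E <=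
   (Q i / t.+1%:R)%:E * P A)%E.
Proof.
move=> ik sA; have mA := past_sigma_measurable sA.
have PA0 : (0 <= P A)%E by [].
have PAE : P A = (fine (P A))%:E by rewrite fineK // fin_num_measure.
have p0 : 0 <= fine (P A) by exact: fine_ge0.
have Q0 : 0 <= Q i by rewrite (le_trans _ (Q_ge i)) // mulr_ge0 ?sqr_ge0.
have small s : (s <= 1)%N ->
  (\int[P]_(w in A) (enorm (z i k s w - br i (y i k w)) ^+ 2)%:E <=
   (Q i / s.+1%:R)%:E * P A)%E.
  move=> s1; apply: (@le_trans _ _ ((diameter (@X i) ^+ 2)%:E * P A)%E).
    apply: integral_le_cst => //; first exact: sa_error_measT.
    by move=> w; rewrite sqr_ge0 sa_error_le.
  rewrite lee_wpmul2r // lee_fin ler_pdivlMr // (le_trans _ (Q_ge i)) //.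
  by rewrite mulrC ler_wpM2r ?sqr_ge0 // ler_nat.
elim: t => [|t IHt]; first exact: small.
have [->|t0] := posnP t; first exact: small.
apply: le_trans (sa_step ik t0 (past_start sA)) _.
set T := t%:R + 1 : R.
have T2 : 2 <= T by rewrite -[2]/(1 + 1) lerD2r ler1n.
have T0 : 0 < T by rewrite (lt_le_trans _ T2).
have c0 : 0 <= 1 - 2 / T by rewrite subr_ge0 ler_pdivrMr // mul1r.
have me : measurable_fun A (fun w => (enorm (z i k t w - br i (y i k w)) ^+ 2)%:E).
  by apply/measurable_EFinP; apply: measurable_funTS; exact: sa_error_measT.
under eq_integral do rewrite EFinD EFinM.
rewrite ge0_integralD //; last 3 first.
- by move=> w _; rewrite mule_ge0 ?lee_fin ?sqr_ge0.
- exact: measurable_funeM.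
- by move=> w _; rewrite lee_fin divr_ge0 ?sqr_ge0.
rewrite ge0_integralZl_EFin //; last by move=> w _; rewrite lee_fin sqr_ge0.
have -> : (\int[P]_(w in A) (Q i / T ^+ 2)%:E = (Q i / T ^+ 2)%:E * P A)%E.
  exact: integral_cst.
apply: (@le_trans _ _ ((1 - 2 / T)%:E * ((Q i / t.+1%:R)%:E * P A) +
   (Q i / T ^+ 2)%:E * P A)%E); first by rewrite leeD2r // lee_wpmul2l.
have -> : t.+1%:R = T :> R by rewrite -natr1.
have -> : t.+2%:R = T + 1 :> R by rewrite -natr1 -natr1.
rewrite PAE -!EFinM -EFinD lee_fin mulrA -mulrDl ler_wpM2r //.
rewrite -subr_ge0.
have -> : Q i / (T + 1) - ((1 - 2 / T) * (Q i / T) + Q i / T ^+ 2) =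
    Q i / (T ^+ 2 * (T + 1)).
  by field; rewrite !gt_eqF // addr_gt0.
by rewrite divr_ge0 // mulr_ge0 ?sqr_ge0 // addr_ge0 // ltW.
Qed.

Lemma filtration_sub i k : filtration I tau x0 smp jj k `<=` <<s past_gen i k 1 >>.
Proof.
apply: smallest_sub; first exact: smallest_sigma_algebra.
move=> A [xA|[j [l [t [lk jl /andP[t0 _] tA]]]]|[j [j' [l [lk jl tA]]]]];
    apply: sub_sigma_algebra.
- by left; apply: sub_sigma_algebra; apply: Or31.
- by left; apply: sub_sigma_algebra; apply: Or32; exists j, l, t.
- by right; apply: sub_sigma_algebra; exists j, j', l.
Qed.

Variable al : 'I_N -> nat -> R.
Hypothesis al_gt0 : forall i k, 0 < al i k.
Hypothesis jj_al : forall i k, i \in I k -> Q i / (jj i k).+1%:R <= al i k ^+ 2.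

Lemma x_next i k w : i \in I k -> block i (x k.+1 w) = z i k (jj i k) w.
Proof. by move=> ik; have [_ ->] := hx; rewrite ik. Qed.

(** F_k is contained in the past enlarged by all delays, on whose events [sa_bound] holds, so the
    integral criterion for conditional bounds applies. *)
Lemma sa_inexact : inexact P xi X psi I tau x0 smp mu al jj x.
Proof.
move=> k i ik; have [msmp _ _ _] := hsmp.
apply: (@cond_exp_le_of_integral _ _ _ P _ _ _ (diameter (@X i) ^+ 2)).
- apply: subset_trans (past_sigma_measurable (i := i) (k := k) (t := 1%N)).
  by apply: subset_trans (@filtration_sub i k); exact: sub_sigma_algebra.
- by under eq_fun do rewrite x_next //; exact: sa_error_measT.
- by move=> w; rewrite sqr_ge0 x_next // sa_error_le.
move=> A /(@filtration_sub i k) sA; under eq_integral do rewrite x_next //.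
apply: le_trans (sa_bound _ ik sA) _.
by rewrite lee_wpmul2r // lee_fin; exact: jj_al.
Qed.

(* Integrate s <= s^2 / (2 a) + a / 2. *)
Lemma first_moment_le (A : set Omega) (g : Omega -> R) (a : R) :
  0 < a -> measurable A -> measurable_fun setT g -> (forall w, 0 <= g w) ->
  (\int[P]_(w in A) (g w ^+ 2)%:E <= (a ^+ 2)%:E * P A)%E ->
  (\int[P]_(w in A) (g w)%:E <= a%:E * P A)%E.
Proof.
move=> a0 mA mg g0 h.
have PAE : P A = (fine (P A))%:E by rewrite fineK // fin_num_measure.
have c0 : 0 <= (2 * a)^-1 by rewrite invr_ge0 mulr_ge0 // ltW.
apply: (@le_trans _ _ (\int[P]_(w in A) ((2 * a)^-1 * g w ^+ 2 + a / 2)%:E)%E).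
  apply: ge0_le_integral => //.
  - by move=> w _; rewrite lee_fin.
  - exact/measurable_EFinP/measurable_funTS.
  - apply/measurable_EFinP/measurable_funTS; apply: measurable_funD => //.
    by apply: measurable_funM => //; exact: measurable_funX.
  move=> w _; rewrite lee_fin -subr_ge0.
  have -> : (2 * a)^-1 * g w ^+ 2 + a / 2 - g w = (2 * a)^-1 * (g w - a) ^+ 2.
    by field; rewrite gt_eqF.
  by rewrite mulr_ge0 ?sqr_ge0.
under eq_integral do rewrite EFinD EFinM.
have mg2 : measurable_fun A (fun w => (g w ^+ 2)%:E).
  by apply/measurable_EFinP/measurable_funTS; exact: measurable_funX.
rewrite ge0_integralD //; last 3 first.
- by move=> w _; rewrite mule_ge0 ?lee_fin ?sqr_ge0.
- exact: measurable_funeM.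
- by move=> w _; rewrite lee_fin divr_ge0 // ltW.
rewrite ge0_integralZl_EFin //; last by move=> w _; rewrite lee_fin sqr_ge0.
have -> : (\int[P]_(w in A) (a / 2)%:E = (a / 2)%:E * P A)%E by exact: integral_cst.
apply: (@le_trans _ _ (((2 * a)^-1)%:E * ((a ^+ 2)%:E * P A) + (a / 2)%:E * P A)%E).
  by rewrite leeD2r // lee_wpmul2l.
rewrite PAE -!EFinM -EFinD lee_fin mulrA -mulrDl.
by have -> : (2 * a)^-1 * a ^+ 2 + a / 2 = a by field; rewrite gt_eqF.
Qed.

(** * Propagation of the error through delayed data *)

Lemma integral_delay_split i j k (A : set Omega) (g : nat -> Omega -> R) :
  i \in I k -> measurable A ->
  (forall s, measurable_fun setT (g s)) -> (forall s w, 0 <= g s w) ->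
  (\int[P]_(w in A) (g (tau i j k w) w)%:E =
   \sum_(s < k.+1) \int[P]_(w in A `&` tau i j k @^-1` [set (s : nat)]) (g s w)%:E)%E.
Proof.
move=> ik mA mg g0; have [_ tauk _] := htau ik.
have mtau s : measurable (tau i j k @^-1` [set s]).
  by apply: all_delays_measurable; exact: tau_set1.
rewrite integral_indicM.
under [RHS]eq_bigr do rewrite integral_indicM.
rewrite -ge0_integral_sum //; last 2 first.
- move=> s; apply/measurable_EFinP; apply: measurable_funM => //.
  exact: measurable_indic (measurableI _ _ mA (mtau s)).
- by move=> s w _; rewrite lee_fin mulr_ge0.
apply: eq_integral => w _; rewrite sumEFin; congr (_%:E).
have tk : (tau i j k w < k.+1)%N by rewrite ltnS.
rewrite (bigD1 (Ordinal tk)) //= big1 ?addr0 => [|s stau].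
  by rewrite !indicE in_setI [X in _ && X]mem_set ?andbT.
rewrite indicE in_setI [X in _ && X]memNset ?andbF ?mul0r //=.
by move=> tw; move/eqP: stau; apply; exact/val_inj.
Qed.

Lemma x_measT k : @meas_rv R _ Omega _ (x k).
Proof.
(* The coordinate s exhibits a player, whose past can be used; without coordinates there is nothing
   to prove. *)
move=> s; have i := tagnat.sig1 s.
exact: (gmeas_meas (past_gen_measurable (t := 1%N)) (@x_meas i k)).
Qed.

Lemma block_error_measT j k : measurable_fun setT (fun w => enorm (block j (x k w) - block j xref)).
Proof.
apply: meas_enorm; apply: meas_rvB; last exact: meas_rv_cst.
by apply: block_meas; exact: x_measT.
Qed.

Variable B2 : nat.
Hypothesis tauB2 : forall k i j, i \in I k -> {ae P, forall w, (tau i j k w <= B2)%N}.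

(** Cutting A along the values of the delay produces delay events again, so the hypothesis applies
    to each piece and the probabilities add up to P A. This closure is why bounds are stated on
    events; pieces with a delay above B2 are negligible. *)
Lemma outdated_error_le i j k (A : set Omega) (V : R) : i \in I k ->
  all_delays I tau A ->
  (forall s B, (s <= k)%N -> (s <= B2)%N -> all_delays I tau B ->
    (\int[P]_(w in B) (enorm (block j (x (k - s)%N w) - block j xref))%:E <= V%:E * P B)%E) ->
  (\int[P]_(w in A) (enorm (block j (y i k w) - block j xref))%:E <= V%:E * P A)%E.
Proof.
move=> ik dA hV; have mA := all_delays_measurable dA.
under eq_integral do rewrite block_outdated.
rewrite (@integral_delay_split i j k A
  (fun s w => enorm (block j (x (k - s)%N w) - block j xref)) ik mA); last 2 first.
- by move=> s; exact: block_error_measT.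
- by move=> s w; exact: enorm_ge0.
have PAE : (P A = \sum_(s < k.+1) P (A `&` tau i j k @^-1` [set (s : nat)]))%E.
  have := @integral_delay_split i j k A (fun _ _ => 1 : R) ik mA (fun=> measurable_cst (1 : R))
    (fun _ _ => ler01).
  rewrite (integral_cst P mA) mul1e => ->; apply: eq_bigr => s _.
  rewrite (integral_cst P) ?mul1e //; apply: measurableI => //.
  by apply: all_delays_measurable; exact: tau_set1.
rewrite PAE ge0_sume_distrr //.
apply: lee_sum => s _.
have dAs : all_delays I tau (A `&` tau i j k @^-1` [set (s : nat)]).
  by apply: setI_sigma => //; exact: tau_set1.
have [sB2|sB2] := leqP s B2; first by apply: hV => //; rewrite -ltnS.
have mAs := all_delays_measurable dAs.
have P0 : P (A `&` tau i j k @^-1` [set (s : nat)]) = 0%E.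
  have [Z [mZ Z0 tZ]] := tauB2 j ik.
  apply: (subset_measure0 mAs mZ _ Z0) => w [_ /= tw]; apply: tZ => /=.
  by rewrite tw leqNgt sB2.
rewrite P0 mule0 null_set_integral //.
by apply/measurable_funTS/measurable_EFinP; exact: block_error_measT.
Qed.

Hypothesis hnash : nash P xi X psi xref.
Local Notation G := (Gamma P xi X psi mu).
Local Notation a := (infty_norm G).

(** The distance splits at the best response: the gradient error contributes al, and the inherited
    errors, all bounded by the same V, contribute V times a row sum of Gamma. *)
Lemma update_error_le i k (A : set Omega) (V : R) : i \in I k ->
  all_delays I tau A -> 0 <= V ->
  (forall j s B, (s <= k)%N -> (s <= B2)%N -> all_delays I tau B ->
    (\int[P]_(w in B) (enorm (block j (x (k - s)%N w) - block j xref))%:E <= V%:E * P B)%E) ->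
  (\int[P]_(w in A) (enorm (block i (x k.+1 w) - block i xref))%:E
     <= (a * V + al i k)%:E * P A)%E.
Proof.
move=> ik dA V0 hV; have mA := all_delays_measurable dA.
have sA : <<s past_gen i k 1 >> A by apply: sub_sigma_algebra; right.
pose t := jj i k.
have mz : measurable_fun A (fun w => (enorm (z i k t w - br i (y i k w)))%:E).
  apply/measurable_funTS/measurable_EFinP; apply: meas_enorm.
  exact: (gmeas_meas (past_gen_measurable (t := t)) (sa_error_meas ik (leqnn t))).
have my j : measurable_fun setT (fun w => enorm (block j (y i k w) - block j xref)).
  apply: meas_enorm; apply: meas_rvB; last exact: meas_rv_cst.
  apply: block_meas; apply: (gmeas_meas (past_gen_measurable (i := i) (k := k) (t := 1%N))).
  by apply: outdated_meas => // l lk; exact: x_meas_le.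
have mGy j : measurable_fun A (fun w => (G i j * enorm (block j (y i k w) - block j xref))%:E).
  apply/measurable_funTS/measurable_EFinP; exact: measurable_funM.
have G0 j : 0 <= G i j by rewrite (Gamma_ge0 hD mu_gt0 Xref).
have Gy0 j w : 0 <= G i j * enorm (block j (y i k w) - block j xref).
  by rewrite mulr_ge0 ?enorm_ge0.
apply: (@le_trans _ _ (\int[P]_(w in A) ((enorm (z i k t w - br i (y i k w)))%:E +
    \sum_j (G i j * enorm (block j (y i k w) - block j xref))%:E))%E).
  apply: ge0_le_integral => //.
  - by move=> w _; rewrite lee_fin enorm_ge0.
  - by apply/measurable_funTS/measurable_EFinP; exact: block_error_measT.
  - by apply: emeasurable_funD => //; exact: emeasurable_sum.
  move=> w _; rewrite sumEFin -EFinD lee_fin x_next //.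
  have -> : z i k t w - block i xref =
      (z i k t w - br i (y i k w)) + (br i (y i k w) - block i xref) by rewrite addrA subrK.
  apply: (le_trans (enormD _ _)); rewrite lerD2l.
  by apply: (prox_br_nash hA hD mu_gt0 Xref) => //; exact: outdated_profiles.
rewrite ge0_integralD //; last 3 first.
- by move=> w _; rewrite lee_fin enorm_ge0.
- by move=> w _; apply: sume_ge0 => j _; rewrite lee_fin.
- exact: emeasurable_sum.
rewrite ge0_integral_sum //; last by move=> j w _; rewrite lee_fin.
have PAE : P A = (fine (P A))%:E by rewrite fineK // fin_num_measure.
have p0 : 0 <= fine (P A) by exact: fine_ge0.
have -> : ((a * V + al i k)%:E * P A = (al i k)%:E * P A + (a * V)%:E * P A)%E.
  by rewrite PAE -!EFinM -EFinD -mulrDl addrC.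
apply: leeD.
  apply: first_moment_le => //.
  - apply: meas_enorm.
    exact: (gmeas_meas (past_gen_measurable (t := t)) (sa_error_meas ik (leqnn t))).
  - by move=> w; exact: enorm_ge0.
  apply: le_trans (sa_bound _ ik sA) _.
  by rewrite lee_wpmul2r // lee_fin; exact: jj_al.
apply: (@le_trans _ _ (\sum_j (G i j * V)%:E * P A)%E).
  apply: lee_sum => j _; under eq_integral do rewrite EFinM.
  rewrite ge0_integralZl_EFin //; last 2 first.
  - by move=> w _; rewrite lee_fin enorm_ge0.
  - exact/measurable_funTS/measurable_EFinP.
  rewrite EFinM -muleA lee_wpmul2l ?lee_fin //.
  by apply: outdated_error_le => // s B; exact: hV.
rewrite PAE; under eq_bigr do rewrite -EFinM.
rewrite sumEFin -EFinM lee_fin -2!mulr_suml ler_wpM2r // ler_wpM2r //.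
exact: Gamma_row_sum.
Qed.

Variable C : R.
Hypothesis C_ge0 : 0 <= C.
Hypothesis hx0C : forall i,
  ('E_P[fun w => (enorm (block i (x0 w) - block i xref) ^+ 2)%R] <= (C ^+ 2)%:E)%E.

(** The starting point is independent of the delays, so its second moment on a delay event is the
    full second moment times P A. *)
Lemma initial_error_le i (A : set Omega) : all_delays I tau A ->
  (\int[P]_(w in A) (enorm (block i (x 0%N w) - block i xref))%:E <= C%:E * P A)%E.
Proof.
move=> dA; have [x0E _] := hx; rewrite x0E; have mA := all_delays_measurable dA.
have [_ _ _ dind] := hsmp.
have ind : independent P (sigma_of x0) <<s all_delays I tau >>.
  rewrite sigma_algebra_id; last exact: smallest_sigma_algebra.
  apply: independentC => B S dB xS; apply: dind => //.
  by apply: sub_sigma_algebra; left.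
pose T1 := g_sigma_algebraType (all_delays I tau).
pose T2 := g_sigma_algebraType [set B : set profile | open B].
have m2 : @meas_rv R _ T2 _ (fun s => block i s - block i xref).
  apply: meas_rvB; last exact: meas_rv_cst.
  by apply: (@block_meas R N n); apply: borel_meas_rv => B oB; apply: sub_sigma_algebra.
pose h (ws : T1 * T2) : \bar R := (\1_A ws.1 * enorm (block i ws.2 - block i xref) ^+ 2)%:E.
have h0 ws : (0 <= h ws)%E by rewrite lee_fin mulr_ge0 ?sqr_ge0.
have mh : measurable_fun setT h.
  apply/measurable_EFinP; apply: measurable_funM.
    apply: measurableT_comp (@measurable_fst _ _ T1 T2).
    apply: (@measurable_indic _ T1 R setT A); exact: sub_sigma_algebra.
  apply: measurable_funX; apply: meas_enorm.
  exact: (meas_rv_comp (@measurable_snd _ _ T1 T2) m2).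
(* Both random elements are [x0], so equality of laws is trivial and independence from the delays
   does the work. *)
have [mint E] := freezing all_delays_measurable hx0 hx0 (fun _ _ => erefl) ind mh h0.
have mg : measurable_fun setT (fun w => enorm (block i (x0 w) - block i xref)).
  by rewrite -x0E; exact: block_error_measT.
have sq : (\int[P]_(w in A) (enorm (block i (x0 w) - block i xref) ^+ 2)%:E
    <= (C ^+ 2)%:E * P A)%E.
  rewrite integral_indicM [leLHS]E /h /=.
  rewrite -(integral_cst P mA) integral_indicM; apply: ge0_le_integral => //.
  - by move=> w _; apply: integral_ge0 => w' _; exact: (h0 (w, x0 w')).
  - by apply/measurable_EFinP; apply: measurable_funM => //; exact: measurable_indic.
  move=> w _; under eq_integral do rewrite EFinM.
  rewrite ge0_integralZl_EFin //; last 2 first.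
  - by move=> w' _; rewrite lee_fin sqr_ge0.
  - by apply/measurable_EFinP; exact: measurable_funX.
  rewrite EFinM lee_wpmul2l //.
  by have := hx0C i; rewrite expectation.unlock.
(* C may vanish while [first_moment_le] requires a positive constant, hence C + e with e tending to
   0. *)
apply/lee_addgt0Pr => e e0.
apply: (@le_trans _ _ ((C + e)%:E * P A)%E).
  apply: first_moment_le => //; first by rewrite ltr_wpDl.
    by move=> w; exact: enorm_ge0.
  apply: le_trans sq _; rewrite lee_wpmul2r // lee_fin lerXn2r ?nnegrE ?addr_ge0 ?(ltW e0) //.
  by rewrite lerDl ltW.
have PAE : P A = (fine (P A))%:E by rewrite fineK // fin_num_measure.
have p1 : fine (P A) <= 1 by rewrite -lee_fin -PAE probability_le1.
rewrite PAE -!EFinM -EFinD lee_fin mulrDl lerD2l.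
by rewrite ler_piMr // ltW.
Qed.

Variables (b : 'I_N -> nat) (B1 n0 : nat) (eta rho : R).
Hypothesis updates : forall i k, exists2 l, (k <= l < k + b i)%N & i \in I l.
Hypothesis bB1 : forall i, (b i <= B1)%N.
Hypothesis B1_gt0 : (0 < B1)%N.
Hypothesis n0B2 : (B2 <= n0 * B1)%N.
Hypothesis rho_ge0 : 0 <= rho.
Hypothesis rho_le1 : rho <= 1.
Hypothesis a_le : a <= rho ^+ n0.+1.
Hypothesis eta_ge0 : 0 <= eta.
Hypothesis eta_le : eta <= rho ^+ n0.+1.
Hypothesis alE : forall i k, al i k = eta ^+ nb_updates I i k.

(* Iterate k was computed at an iteration l > k - 1 - B1 from data of age at
   most B2 <= n0 B1, so that the factor a <= rho^(n0 + 1) compensates for the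
   n0 windows lost to the delay and gains one more. *)
Lemma error_bound k i (A : set Omega) : all_delays I tau A ->
  (\int[P]_(w in A) (enorm (block i (x k w) - block i xref))%:E
     <= (rho ^+ (k %/ B1) * (C + k%:R))%:E * P A)%E.
Proof.
suff : forall K k i A, (k <= K)%N -> all_delays I tau A ->
  (\int[P]_(w in A) (enorm (block i (x k w) - block i xref))%:E
     <= (rho ^+ (k %/ B1) * (C + k%:R))%:E * P A)%E by move=> h; exact: (h k).
have [_ xS] := hx.
elim=> [|K IHK] {}k {}i {}A; rewrite ?leqn0 => kK dA.
  move/eqP: kK => ->; rewrite div0n mul1r addr0; exact: initial_error_le.
move: kK; rewrite leq_eqVlt ltnS => /predU1P[->|kK]; last exact: IHK.
(* Between updates the block is constant, so only the last update at some l <= K has to be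
   estimated. *)
have frozen l : (l <= K)%N -> (forall l', (l < l' <= K)%N -> i \notin I l') ->
    block i \o x K.+1 = block i \o x l.+1.
  move=> lK; elim: K lK {IHK} => [|K IHK] lK no.
    by move: lK; rewrite leqn0 => /eqP ->.
  move: lK; rewrite leq_eqVlt ltnS => /predU1P[->//|lK].
  rewrite -IHK // => [|l' /andP[ll' l'K]]; last by apply: no; rewrite ll' leqW.
  apply/funext => w /=; rewrite xS; case: ifPn => // iK.
  by have := no K.+1; rewrite ltnS lK leqnn => /(_ isT); rewrite iK.
have [[KB1 no]|[l [lK KlB il no]]] := last_update updates bB1 i K.
  have -> : (fun w => (enorm (block i (x K.+1 w) - block i xref))%:E) =
      (fun w => (enorm (block i (x 0%N w) - block i xref))%:E).
    apply/funext => w; have := frozen 0%N isT.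
    rewrite -[block i (x K.+1 w)]/((block i \o x K.+1) w) => ->.
      by rewrite /= xS (negbTE (no 0%N isT)).
    by move=> l' /andP[_]; exact: no.
  apply: le_trans (initial_error_le i dA) _.
  rewrite divn_small // mul1r lee_wpmul2r // lee_fin lerDl //.
have -> : (fun w => (enorm (block i (x K.+1 w) - block i xref))%:E) =
    (fun w => (enorm (block i (x l.+1 w) - block i xref))%:E).
  by apply/funext => w; rewrite -[block i (x K.+1 w)]/((block i \o x K.+1) w) (frozen l).
(* The truncated subtraction covers the early iterations with l / B1 < n0, where no decay is
   available yet. *)
pose V := rho ^+ (l %/ B1 - n0) * (C + l%:R).
have V0 : 0 <= V by rewrite mulr_ge0 ?exprn_ge0 ?addr_ge0.
have hV j s B : (s <= l)%N -> (s <= B2)%N -> all_delays I tau B ->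
    (\int[P]_(w in B) (enorm (block j (x (l - s)%N w) - block j xref))%:E <= V%:E * P B)%E.
  move=> sl sB2 dB; apply: le_trans (IHK (l - s)%N j B _ dB) _.
    by rewrite (leq_trans (leq_subr _ _)).
  rewrite lee_wpmul2r // lee_fin; apply: ler_pM; rewrite ?exprn_ge0 ?addr_ge0 //.
    rewrite ler_wiXn2l // leq_subLR -divnMDl // leq_div2r //.
    by rewrite -leq_subLR; apply: leq_sub2l; exact: leq_trans sB2 n0B2.
  by rewrite lerD2l ler_nat leq_subr.
apply: le_trans (update_error_le il dA V0 hV) _.
rewrite lee_wpmul2r // lee_fin.
have e1 : a * V <= rho ^+ (l %/ B1).+1 * (C + l%:R).
  apply: (@le_trans _ _ (rho ^+ n0.+1 * V)); first by rewrite ler_wpM2r.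
  rewrite /V mulrA -exprD ler_wpM2r ?addr_ge0 // ler_wiXn2l //.
  by rewrite addSn ltnS -leq_subLR.
have e2 : al i l <= rho ^+ (l %/ B1).+1.
  have eta1 : eta <= 1 by rewrite (le_trans eta_le) // exprn_ile1.
  rewrite alE (@le_trans _ _ (eta ^+ (l %/ B1).+1)) //.
    by rewrite ler_wiXn2l // (nb_updates_ge updates bB1).
  rewrite lerXn2r ?nnegrE // (le_trans eta_le) // -[leRHS]expr1 ler_wiXn2l //.
apply: (@le_trans _ _ (rho ^+ (l %/ B1).+1 * (C + l.+1%:R))).
  by rewrite -natr1 addrA [leRHS]mulrDr mulr1 lerD.
(* From K + 1 <= l + B1 the integer part of (K + 1) / B1 is at most that of l / B1 plus one. *)
apply: ler_pM; rewrite ?exprn_ge0 ?addr_ge0 //.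
  by rewrite ler_wiXn2l // -[(l %/ B1).+1]add1n -divnMDl // mul1n addnC leq_div2r.
by rewrite lerD2l ler_nat ltnS.
Qed.

End Scheme.

(** * Schedule, stopping iteration and step count *)

Theorem theorem3 (R : realType) (d : measure_display) (Omega : measurableType d)
    (P : probability Omega R)
    (N m : nat) (n : 'I_N -> nat)
    (xi : Omega -> 'rV[R]_m)
    (X : forall i, set 'rV[R]_(n i))
    (psi : 'I_N -> 'rV[R]_(\sum_i n i) -> 'rV[R]_m -> R)
    (M : 'I_N -> R) (hA : assumptionA P xi X psi M)
    (hD : assumptionD P xi X psi)
    (mu : R) (hmu : 0 < mu)
    (xstar : 'rV[R]_(\sum_i n i)) (hxstar : nash P xi X psi xstar)
    (I : nat -> {set 'I_N})
    (tau : 'I_N -> 'I_N -> nat -> Omega -> nat) (htau : delays_ok I tau)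
    (b : 'I_N -> nat) (B1 B2 : nat) (taubar : 'I_N -> 'I_N -> Omega -> nat)
    (hS : assumptionS P I tau b B1 B2 taubar)
    (x0 : Omega -> 'rV[R]_(\sum_i n i))
    (hx0 : random_element x0) (hx0X : forall w, profiles X (x0 w))
    (smp : 'I_N -> nat -> nat -> Omega -> 'rV[R]_m)
    (hsmp : sampling P xi I tau x0 smp)
    (C : R) (hC : 0 <= C)
    (hx0C : forall i, ('E_P[fun w => (enorm (block i (x0 w) - block i xstar) ^+ 2)%R]
                         <= (C ^+ 2)%:E)%E)
    (eta : R) (heta : 0 < eta < 1) :
  let a := infty_norm (Gamma P xi X psi mu) in
  let n0 : R := (Num.ceil (B2%:R / B1%:R : R))%:~R in
  let rho := (Num.max a eta) `^ (1 / (n0 + 1)) in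
  let c := rho `^ (1 / B1%:R) in
  let Q i := 2 * M i ^+ 2 / mu ^+ 2 + 2 * diameter (X i) ^+ 2 in
  let alpha i k := eta ^+ nb_updates I i k in
  exists (jj : 'I_N -> nat -> nat)
         (x : nat -> Omega -> 'rV[R]_(\sum_i n i)),
    [/\ sa_run X psi I tau x0 smp mu jj x,
        inexact P xi X psi I tau x0 smp mu alpha jj x &
        forall (q D eps : R),
          c < q < 1 -> 1 / ln ((q / c) `^ expR 1) <= D -> 0 < eps ->
          let epshat := eps / (C + D) * rho `^ ((B1%:R - 1) / B1%:R) in
          exists K : nat,
            [/\ eps_NE_infty P xstar eps (x K),
                forall i, (nb_steps I jj i K)%:R <=
                  Q i / (eta ^+ 4 * ln (1 / eta ^+ 2)) *
                    (1 / epshat) `^ (ln (1 / eta ^+ 2) / ln (1 / q)) +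
                  (Num.max 0 (Num.ceil (ln (1 / epshat) / ln (1 / q))))%:~R &
                B1 = 1%N -> B2 = 0%N ->
                  c = Num.max a eta /\
                  forall i, (nb_steps I jj i K)%:R <=
                    Q i / (eta ^+ 4 * ln (1 / eta ^+ 2)) *
                      ((C + D) / eps) `^ (ln (1 / eta ^+ 2) / ln (1 / q))]].
Proof.
move=> a n0 rho c Q alpha.
have [eta0 eta1] := andP heta.
have Xs : profiles X xstar by case: hxstar.
have [upds B1_gt0 bB1 _ [tauS tauB]] := hS.
have B1r : 0 < B1%:R :> R by rewrite ltr0n.
have a0 : 0 <= a := infty_norm_ge0 P xi X psi mu.
have a1 : a < 1 := infty_norm_Gamma_lt1 hD hmu Xs.
set sigma := Num.max a eta.
have s0 : 0 < sigma by rewrite lt_max eta0 orbT.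
have s1 : sigma < 1 by rewrite gt_max a1 eta1.
have n0_ge0 : (0 <= Num.ceil (B2%:R / B1%:R : R))%R.
  by rewrite ceil_ge0 (lt_le_trans (ltrN10 _)) // divr_ge0.
pose n1 := `|Num.ceil (B2%:R / B1%:R : R)|%N.
have n1E : n0 = n1%:R by rewrite /n0 -[in LHS](gez0_abs n0_ge0).
have n1B2 : (B2 <= n1 * B1)%N.
  rewrite -(ler_nat R) natrM -ler_pdivrMr // -n1E /n0; exact: ceil_ge.
have n1pos : 0 < n0 + 1 by rewrite n1E natr1 ltr0n.
have rho0 : 0 < rho by rewrite powR_gt0.
have rhoE : rho ^+ n1.+1 = sigma.
  rewrite -powR_mulrn ?(ltW rho0) // /rho -powRrM n1E natr1 div1r mulVf ?powRr1 //.
  exact: ltW.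
have rho1 : rho < 1.
  rewrite ltNge; apply/negP => h; have := exprn_ege1 n1.+1 h.
  by rewrite rhoE leNgt s1.
have Q0 i : 0 <= Q i.
  apply: addr_ge0; last by apply: mulr_ge0; [|exact: sqr_ge0].
  by apply: divr_ge0; [apply: mulr_ge0; [|exact: sqr_ge0]|exact: sqr_ge0].
have al0 i k : 0 < alpha i k by rewrite exprn_gt0.
(* The error after t steps is at most Q / (t + 1), so that the integer part of
   Q / alpha^2 is enough; rounding up would lose the case B1 = 1, B2 = 0. *)
pose jj i k := Num.truncn (Q i / alpha i k ^+ 2).
have jj_ge i k : i \in I k -> Q i / (jj i k).+1%:R <= alpha i k ^+ 2.
  move=> _; rewrite ler_pdivrMr ?ltr0n // mulrC -ler_pdivrMr ?exprn_gt0 //.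
  exact/ltW/truncnS_gt.
have jj_le i k : i \in I k -> (jj i k)%:R <= Q i / (alpha i k) ^+ 2.
  by move=> _; rewrite truncn_le // divr_ge0 ?sqr_ge0.
have [x xrun] := @sa_run_exists R d Omega N m n X psi I tau x0 smp mu jj.
exists jj, x; split=> //.
  exact: (sa_inexact hA hD hmu Xs htau hx0 hx0X hsmp xrun jj_ge).
move=> q D eps cq hDq eps0 epshat.
have [cq1 q1] := andP cq.
have c0 : 0 < c by rewrite powR_gt0.
have q0 : 0 < q := lt_trans c0 cq1.
have D0 : 0 < D.
  apply: lt_le_trans hDq; rewrite div1r invr_gt0 ln_powR mulr_gt0 ?expR_gt0 //.
  by rewrite ln_gt0 // ltr_pdivlMr // mul1r.
have eh0 : 0 < epshat by rewrite mulr_gt0 ?powR_gt0 // divr_gt0 // ltr_wpDl.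
pose L := ln (1 / epshat) / ln (1 / q).
(* L is negative as soon as epshat exceeds 1; then K = 0 and the starting point already
   qualifies. *)
pose K := absz (Num.max 0 (Num.ceil L)).
have KE : (Num.max 0 (Num.ceil L))%:~R = K%:R :> R.
  by rewrite -[in LHS](@gez0_abs (Num.max 0 (Num.ceil L))) ?le_max ?lexx.
have LK : L <= K%:R.
  rewrite -KE (le_trans (ceil_ge L)) // ler_int le_max lexx orbT //.
(* Rounding up costs at most one iteration where the cut at 0 is inactive; K = 0 is treated apart,
   as it takes no gradient step. *)
have K_gt0 : (0 < K)%N -> K%:R <= L + 1.
  rewrite -KE /K; have [cL|cL] := lerP (Num.ceil L) 0; first by rewrite absz0.
  by move=> _; have := ceilB1_lt L; rewrite rmorphB /= ltrBlDr => /ltW.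
have tauB2 k i j : i \in I k -> {ae P, forall w, (tau i j k w <= B2)%N}.
  move=> ik; have := tauS k i j ik; have := tauB i j.
  by apply: filterS2 => w h1 h2; exact: leq_trans h2 h1.
(* The bound without the ceiling yields both conclusions: the general one adds a nonnegative term,
   the special one substitutes rho and epshat. *)
have steps i : (nb_steps I jj i K)%:R <=
    Q i / (eta ^+ 4 * ln (1 / eta ^+ 2)) *
      (1 / epshat) `^ (ln (1 / eta ^+ 2) / ln (1 / q)).
  have r1 : 1 < 1 / eta ^+ 2 by rewrite div1r invf_gt1 ?exprn_gt0 // exprn_ilt1 // ltW.
  have l0 : 0 < ln (1 / eta ^+ 2) by rewrite ln_gt0.
  have [->|Kpos] := posnP K.
    by rewrite /nb_steps big_ord0 mulr_ge0 ?powR_ge0 // divr_ge0 // mulr_ge0 ?exprn_ge0 // ltW.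
  apply: le_trans (nb_steps_geom (Q0 i) heta (@jj_le i) K) _.
  have q01 : 0 < q < 1 by rewrite q0.
  have := steps_threshold heta q01 eh0 (K_gt0 Kpos).
  set E := (1 / epshat) `^ _ => h.
  have QE : Q i / (eta ^+ 4 * ln (1 / eta ^+ 2)) * E =
      Q i / ln (1 / eta ^+ 2) * (1 / eta ^+ 4 * E).
    by field; rewrite !gt_eqF ?exprn_gt0.
  rewrite QE ler_wpM2l ?divr_ge0 ?(ltW l0) // (le_trans _ h) //.
  by rewrite ler_weXn2l ?(ltW r1) // ltnS sum_updates_le.
exists K; split.
- apply: bigmax_le => [|i _]; first exact: leNye.
  rewrite expectation.unlock.
  (* The whole space is a delay event, so the bound on events specializes to the expectation. *)
  have dT : all_delays I tau setT by exact: setT_sigma.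
  have := error_bound hA hD hmu Xs htau hx0 hx0X hsmp xrun al0 jj_ge tauB2 hxstar
    hC hx0C upds bB1 B1_gt0 n1B2 (ltW rho0) (ltW rho1) _ (ltW eta0) _ (fun _ _ => erefl) K i dT.
  rewrite rhoE !le_max !lexx orbT => /(_ isT isT); rewrite probability_setT mule1 => h.
  apply: le_trans h _; rewrite lee_fin.
  exact: (error_threshold rho0 (ltW rho1) B1_gt0 hC eps0 cq hDq LK).
- by move=> i; rewrite (le_trans (steps i)) // lerDl ler0z le_max lexx.
move=> B11 B20.
have n00 : n0 = 0 by rewrite /n0 B20 mul0r ceil0.
have rhoS : rho = sigma by rewrite /rho n00 add0r divr1 powRr1 // ltW.
split; first by rewrite /c B11 divr1 powRr1 ?(ltW rho0).
move=> i; apply: (le_trans (steps i)); rewrite /epshat B11 subrr mul0r powRr0 mulr1.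
by rewrite [1 / (eps / _)]div1r invf_div.
Qed.
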